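(* Let $K\subset\mathbb{R}^d$ be a mesh element which is a Lipschitz domain satisfying the sub-element (local star-shapedness) assumption recalled in the context, with boundary pieces $F_i$, sub-elements $K_{F_i}=K_{F_i}(\mathbf{x}_i^0)\subset K$ and $\mathbf{m}_i(\mathbf{x})=\mathbf{x}-\mathbf{x}_i^0$, $i=1,\dots,n_K$. Let $p\in\mathbb{N}$. Then, for each $F_i\subset\partial K$, $i=1,\dots,n_K$, and for each $v\in\mathcal{P}_p(K)$, $$\|v\|_{F_i}^2\le\frac{(p+1)(p+d)}{\min_{\mathbf{x}\in F_i}(\mathbf{m}_i\cdot\mathbf{n})}\,\|v\|_{K_{F_i}}^2 .$$
   Context: Notation: $\|\cdot\|_{\omega}$ is the $L_2(\omega)$-norm (with respect to surface measure if $\omega$ is a $(d-1)$-dimensional surface); $\mathcal{P}_p(\omega)$ is the space of polynomials of total degree at most $p$ on $\omega$; $\mathbf{n}$ is the unit outward normal vector. Sub-element assumption on $K$: $K$ is a Lipschitz domain, and $\partial K$ can be subdivided into mutually exclusive subsets $\{F_i\}_{i=1}^{n_K}$ with the following property: there exist respective sub-elements $K_{F_i}\equiv K_{F_i}(\mathbf{x}_i^0)\subset K$ with $d$ planar faces meeting at one vertex $\mathbf{x}_i^0\in K$, with $F_i\subset\partial K_{F_i}$ (so $K_{F_i}$ is bounded by $F_i$, possibly curved, and by $d$ planar faces meeting at $\mathbf{x}_i^0$), such that for $i=1,\dots,n_K$: (a) $K_{F_i}$ is star-shaped with respect to $\mathbf{x}_i^0$; (b) $\mathbf{m}_i(\mathbf{x})\cdot\mathbf{n}(\mathbf{x})>0$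 for $\mathbf{x}\in F_i$, where $\mathbf{m}_i(\mathbf{x}):=\mathbf{x}-\mathbf{x}_i^0$ and $\mathbf{n}(\mathbf{x})$ is the unit outward normal to $F_i$ at $\mathbf{x}$. The $F_i$ need not coincide with the faces of $K$. *)

(* Defs.v *)
From HB Require Import structures.
From mathcomp Require Import all_boot all_order all_algebra.
From mathcomp Require Import all_classical all_reals all_analysis.
(* The notations of mpoly clash with those of mathcomp-analysis; the canonical
   structures are needed for [mpoly.msize]. *)
From mathcomp Require Import (canonicals, coercions) mpoly.

Set Implicit Arguments.
Unset Strict Implicit.
Unset Printing Implicit Defensive.

Import Order.TTheory GRing.Theory Num.Theory.
Import numFieldNormedType.Exports.

Local Open Scope classical_set_scope.
Local Open Scope ring_scope.

Definition rV_display : measure_display. Proof. exact: default_measure_display. Qed.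

Section measurable_rV.
Context (R : realType) (n : nat).

Let coor (i : 'I_n) (x : 'rV[R]_n) : measurableTypeR R := x 0 i.

Definition rV_measurable : set (set 'rV[R]_n) := g_sigma_preimage coor.

Let rV_measurable0 : rV_measurable set0.
Proof. exact: sigma_algebra0. Qed.

Let rV_measurableC A : rV_measurable A -> rV_measurable (~` A).
Proof. exact: sigma_algebraC. Qed.

Let rV_measurable_bigcup (F : (set 'rV[R]_n)^nat) :
  (forall i, rV_measurable (F i)) -> rV_measurable (\bigcup_i F i).
Proof. exact: sigma_algebra_bigcup. Qed.

(* The sigma-algebra generated by the coordinates, as for [n.-tuple T] in the
   library; it is the Borel sigma-algebra. *)
HB.instance Definition _ := @isMeasurable.Build rV_display 'rV[R]_n
  rV_measurable rV_measurable0 rV_measurableC rV_measurable_bigcup.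

End measurable_rV.

Lemma measurable_coor (R : realType) n (i : 'I_n) :
  measurable_fun [set: 'rV[R]_n] (fun x => x 0 i : measurableTypeR R).
Proof.
move=> _ Y mY; rewrite setTI; apply: sub_sigma_algebra => /=.
rewrite -bigcup_seq/=; exists i => /=; first by rewrite mem_index_enum.
by exists Y => //; rewrite setTI.
Qed.

Lemma measurable_fun_rV d (T : measurableType d) (R : realType) n
    (f : T -> 'rV[R]_n) :
  (forall i, measurable_fun setT (fun t => f t 0 i : measurableTypeR R)) ->
  measurable_fun setT f.
Proof.
move=> mf; apply: (measurability _ (erefl : @measurable _ 'rV[R]_n = <<s _ >>)).
move=> _ [B + <-]; rewrite setTI -bigcup_seq => -[i /= _ [A mA <-]].
by rewrite setTI; have := mf i measurableT A mA; rewrite setTI.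
Qed.

Section cons_rV.
Context (R : realType) (n : nat).

Definition cons_rV (z : measurableTypeR R * 'rV[R]_n) : 'rV[R]_n.+1 :=
  row_mx (z.1 : R)%:M z.2.

Definition uncons_rV (x : 'rV[R]_n.+1) : measurableTypeR R * 'rV[R]_n :=
  (x 0 0, \row_i x 0 (lift 0 i)).

Lemma cons_rVK : cancel cons_rV uncons_rV.
Proof.
move=> [a x]; congr (_, _).
  rewrite (_ : 0 = lshift n (0 : 'I_1)) ?(@row_mxEl _ 1 1 n) ?mxE//.
  exact: val_inj.
apply/rowP => i; rewrite mxE (_ : lift 0 i = rshift 1 i) ?(@row_mxEr _ 1 1 n)//.
exact: val_inj.
Qed.

Let measurable_cons_rV : measurable_fun setT cons_rV.
Proof.
apply: measurable_fun_rV => i; case: (unliftP 0 i) => [j|] ->.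
- rewrite (_ : (fun _ => _) = (fun x : 'rV[R]_n => x 0 j : measurableTypeR R) \o snd).
    by apply: measurableT_comp; [exact: measurable_coor|exact: measurable_snd].
  apply/funext => z; have := congr1 (fun w : _ * 'rV[R]_n => w.2 0 j) (cons_rVK z).
  by rewrite /= mxE.
- rewrite (_ : (fun _ => _) = fst); first exact: measurable_fst.
  by apply/funext => z; exact: (congr1 fst (cons_rVK z)).
Qed.

HB.instance Definition _ :=
  isMeasurableFun.Build _ _ _ _ cons_rV measurable_cons_rV.

Lemma measurable_uncons_rV : measurable_fun setT uncons_rV.
Proof.
apply/measurable_fun_pairP; split; first exact: measurable_coor.
apply: measurable_fun_rV => i; rewrite (_ : (fun _ => _) =
  (fun x : 'rV[R]_n.+1 => x 0 (lift 0 i) : measurableTypeR R)).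
  exact: measurable_coor.
by apply/funext => x; rewrite /= mxE.
Qed.

Variable mu : {sigma_finite_measure set 'rV[R]_n -> \bar R}.

Definition cons_measure : set 'rV[R]_n.+1 -> \bar R :=
  pushforward (@lebesgue_measure R \x mu)%E cons_rV.

Let cons_measure0 : cons_measure set0 = 0%E.
Proof. exact: measure0. Qed.

Let cons_measure_ge0 A : (0 <= cons_measure A)%E.
Proof. exact: measure_ge0. Qed.

Let cons_measure_sigma_additive : semi_sigma_additive cons_measure.
Proof. exact: measure_semi_sigma_additive. Qed.

HB.instance Definition _ := isMeasure.Build _ _ _ cons_measure
  cons_measure0 cons_measure_ge0 cons_measure_sigma_additive.

Let cons_measure_sigma_finite : sigma_finite setT cons_measure.
Proof.
have /sigma_finiteP[F [FT ndF Foo]] := sigma_finiteT (@lebesgue_measure R).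
have /sigma_finiteP[G [GT ndG Goo]] := sigma_finiteT mu.
exists (fun k => uncons_rV @^-1` (F k `*` G k)).
  rewrite -preimage_bigcup (_ : \bigcup_k _ = setT) ?preimage_setT//.
  apply/seteqP; split => // -[a x] _.
  have [[i _ Fia] [j _ Gjx]] : (\bigcup_k F k) a /\ (\bigcup_k G k) x.
    by rewrite -FT -GT.
  exists (maxn i j) => //; split.
  - by move: a Fia; exact/subsetPset/ndF/leq_maxl.
  - by move: x Gjx; exact/subsetPset/ndG/leq_maxr.
move=> k; have [mF Fk] := Foo k; have [mG Gk] := Goo k; split.
  by rewrite -[X in measurable X]setTI; apply: measurable_uncons_rV => //;
    exact: measurableX.
rewrite /cons_measure /pushforward -comp_preimage (_ : _ \o _ = id); last first.
  by apply/funext => z; exact: cons_rVK.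
by rewrite preimage_id product_measure1E// lte_mul_pinfty// ge0_fin_numE.
Qed.

HB.instance Definition _ := Measure_isSigmaFinite.Build _ _ _ cons_measure
  cons_measure_sigma_finite.

End cons_rV.

Fixpoint lebesgue_rV (R : realType) n :
    {sigma_finite_measure set 'rV[R]_n -> \bar R} :=
  if n is m.+1 then cons_measure (lebesgue_rV R m) else \d_(0 : 'rV[R]_0).

Section geometry.
Context (R : realType).

Definition dot n (u v : 'rV[R]_n) : R := \sum_i u 0 i * v 0 i.

Definition boundary n (A : set 'rV[R]_n) : set 'rV[R]_n :=
  closure A `\` interior A.

(* The centre may lie on the boundary of an open set A (such as the vertex of a
   sub-element), hence the segments are half-open at x0. *)
Definition star_shaped n (A : set 'rV[R]_n) (x0 : 'rV[R]_n) : Prop :=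
  forall x, A x -> forall t : R, 0 < t <= 1 -> A (x0 + t *: (x - x0)).

Definition hyperplane n (a x0 : 'rV[R]_n) : set 'rV[R]_n :=
  [set x | dot a (x - x0) = 0].

Definition gradient n (phi : 'rV[R]_n -> R) (y : 'rV[R]_n) : 'rV[R]_n :=
  \row_i 'D_(delta_mx 0 i) phi y.

Definition area_factor n (phi : 'rV[R]_n -> R) (y : 'rV[R]_n) : R :=
  Num.sqrt (1 + dot (gradient phi y) (gradient phi y)).

(* The point of local coordinates (s, y), in the orthonormal frame given by the
   rows of [chart_frame], is [cons_rV (s, y) *m chart_frame]; the first
   coordinate s is the height above the base space of y. *)
Record chart n := Chart {
  chart_frame : 'M[R]_n.+1;
  chart_fun : 'rV[R]_n -> R;
  chart_nbhs : set 'rV[R]_n.+1 }.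

Definition chart_point n (c : chart n) (s : R) (y : 'rV[R]_n) : 'rV[R]_n.+1 :=
  cons_rV (s, y) *m chart_frame c.

Definition graph_point n (c : chart n) (y : 'rV[R]_n) : 'rV[R]_n.+1 :=
  chart_point c (chart_fun c y) y.

(* Inside [chart_nbhs c], the set K is the strict subgraph of a Lipschitz
   function; its boundary is then the graph. *)
Definition is_chart n (K : set 'rV[R]_n.+1) (c : chart n) : Prop :=
  [/\ chart_frame c *m (chart_frame c)^T = 1%:M,
      lipschitz (chart_fun c),
      open (chart_nbhs c) &
      forall s y, chart_nbhs c (chart_point c s y) ->
        K (chart_point c s y) <-> s < chart_fun c y].

Definition lipschitz_domain n (K : set 'rV[R]_n.+1) : Prop :=
  [/\ K !=set0, open K, connected K, bounded_set K &
      forall x, boundary K x -> exists2 c, is_chart K c & chart_nbhs c x].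

Definition is_atlas n (K : set 'rV[R]_n.+1) N (cs : 'I_N -> chart n) : Prop :=
  (forall j, is_chart K (cs j)) /\
  boundary K `<=` \bigcup_j chart_nbhs (cs j).

(* nu is the unit outward normal to K at its boundary point x: in local
   coordinates, (1, - grad phi) / sqrt (1 + |grad phi|^2). It is defined where
   phi is differentiable, that is (Rademacher) almost everywhere. *)
Definition outward_normal n (K : set 'rV[R]_n.+1) (x nu : 'rV[R]_n.+1) : Prop :=
  exists c, exists y,
    [/\ is_chart K c, chart_nbhs c x, x = graph_point c y,
        differentiable (chart_fun c) y &
        nu = (area_factor (chart_fun c) y)^-1 *:
             chart_point c 1 (- gradient (chart_fun c) y)].

(* Surface integral over the part A of the graph. The integrand is defined at
   the points of differentiability of phi, that is almost everywhere. *)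
Definition chart_integral n (c : chart n) (A : set 'rV[R]_n.+1)
    (f : 'rV[R]_n.+1 -> R) : \bar R :=
  (\int[lebesgue_rV R n]_(y in [set y | A (graph_point c y) /\
                                       differentiable (chart_fun c) y])
    (f (graph_point c y) * area_factor (chart_fun c) y)%:E)%E.

(* Surface integral over a subset F of the boundary, cut into the disjoint
   pieces that lie in the first, second, etc. chart of a finite atlas; its value
   does not depend on the atlas. *)
Definition surface_integral n N (cs : 'I_N -> chart n) (F : set 'rV[R]_n.+1)
    (f : 'rV[R]_n.+1 -> R) : \bar R :=
  (\sum_(j < N) chart_integral (cs j)
     (F `&` (chart_nbhs (cs j) `\`
             \bigcup_(k in [set k : 'I_N | (k < j)%N]) chart_nbhs (cs k))) f)%E.

Definition sqnorm_surface n N (cs : 'I_N -> chart n) (F : set 'rV[R]_n.+1)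
    (v : 'rV[R]_n.+1 -> R) : \bar R :=
  surface_integral cs F (fun x => v x ^+ 2).

Definition sqnorm_volume n (D : set 'rV[R]_n) (v : 'rV[R]_n -> R) : \bar R :=
  (\int[lebesgue_rV R n]_(x in D) (v x ^+ 2)%:E)%E.

(* [mpoly.msize] is the total degree plus one, and 0 for the zero polynomial. *)
Definition poly_space n (p : nat) : set ('rV[R]_n -> R) :=
  [set v | exists2 q : mpoly.mpoly n R,
     (mpoly.msize q <= p.+1)%N & v = fun x : 'rV[R]_n => mpoly.meval (fun i => x 0 i) q].

(* KF is the sub-element with vertex x0 attached to the piece F of the boundary
   of K; it is bounded by F and by n.+1 planar faces P j meeting at x0. *)
Definition sub_element n (K F KF : set 'rV[R]_n.+1) (x0 : 'rV[R]_n.+1) : Prop :=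
  [/\ open KF /\ KF `<=` K, K x0, F `<=` boundary KF,
      (exists P : 'I_n.+1 -> set 'rV[R]_n.+1,
        [/\ forall j, exists2 a, a != 0 & P j `<=` hyperplane a x0,
            \bigcap_j P j = [set x0] &
            boundary KF = closure F `|` \bigcup_j P j]) &
      star_shaped KF x0 /\
      forall x nu, F x -> outward_normal K x nu -> 0 < dot (x - x0) nu].

Definition sub_element_assumption n (K : set 'rV[R]_n.+1) (nK : nat)
    (F KF : 'I_nK -> set 'rV[R]_n.+1) (x0 : 'I_nK -> 'rV[R]_n.+1) : Prop :=
  [/\ forall i, measurable (F i), trivIset setT F,
      \bigcup_i F i = boundary K &
      forall i, sub_element K (F i) (KF i) (x0 i)].

(* The minimum of m . n over F, as an infimum: it need not be attained, since F
   may be non-closed and the normal discontinuous. *)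
Definition min_m_dot_n n (K F : set 'rV[R]_n.+1) (x0 : 'rV[R]_n.+1) : \bar R :=
  ereal_inf [set z | exists x nu,
    [/\ F x, outward_normal K x nu & z = (dot (x - x0) nu)%:E]].

End geometry.

(* Main.v *)
(* On each ray from x0, the trace v(x) is recovered from v by the reproducing
   kernel of the polynomials of degree at most p for the weight t^(d-1) on
   [0, 1], whose value at (1, 1) is \sum_(k <= p) (2k + d) = (p + 1) (p + d); so
     v(x)^2 <= (p + 1) (p + d) \int_0^1 v(x0 + t (x - x0))^2 t^(d-1) dt.
   Multiplying by (x - x0) . n, which is at least its infimum, and
   integrating over F gives the claim, provided the cone over F satisfies
     \int_F (x - x0) . n \int_0^1 f(x0 + t (x - x0)) t^(d-1) dt <= \int_KF f.
   Only an inequality is needed here, and F is merely a union of graphs of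
   Lipschitz functions: rescaling the base variable by t reduces it, on each
   line parallel to the axis of a chart, to the inequality
   \int_T s' <= |s(T)| for functions of one variable, differentiable at the
   points of T. The cones over distinct points of F are disjoint, because the
   closure of KF is star-shaped and, by (x - x0) . n > 0, does not extend beyond
   x on the ray through x. *)
Require Import Defs.
From HB Require Import structures.
From mathcomp Require Import all_boot all_order all_algebra.
From mathcomp Require Import all_classical all_reals all_analysis.
From mathcomp Require Import (canonicals, coercions) mpoly.
From mathcomp Require Import measurable_realfun ring lra zify.

Set Implicit Arguments.
Unset Strict Implicit.
Unset Printing Implicit Defensive.

Import Order.TTheory GRing.Theory Num.Theory.
Import numFieldNormedType.Exports.

Local Open Scope classical_set_scope.
Local Open Scope ring_scope.

(** The set where a chart function is differentiable is not shown to be measurable, and the surface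
    integral over it is a lower integral; it is first replaced by the integral over a measurable
    subset with the same value. Images met later must be measurable too: they are rewritten as
    preimages by means of the gauge of the closure of the sub-element, which gives back the ratio t
    of a cone point and so is a measurable left inverse. With d = n + 1, the factor t^n is the
    Jacobian of the rescaling of the base space. What remains of the Jacobian is the derivative in t
    of the height of the cone above a fixed base point, and it equals (x - x0) . n times the area
    factor. The infimum of (x - x0) . n may be 0. The bound is then +oo, unless v has norm 0 on the
    sub-element: there +oo times 0 is 0, and v must be shown to vanish almost everywhere on the
    pieces of F. The inequality weighted by (x - x0) . n, which is positive at every point, gives
    this. *)

(** * Borel sets and affine changes of variables in row vectors *)

Lemma open_measurable_rV (R : realType) n (A : set 'rV[R]_n) :
  open A -> measurable A.
Proof.
move=> oA.
(* The sigma-algebra is generated by the coordinates, so an open set is written as a countable union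
   of boxes: those of rational centre and half-width 1/(k+1) that it contains. *)
pose B (z : 'rV[rat]_n * nat) : set 'rV[R]_n :=
  [set x | forall i, `|x 0 i - ratr (z.1 0 i)| < z.2.+1%:R^-1].
have mB z : measurable (B z).
  have -> : B z = \bigcap_(i in [set: 'I_n]) ((fun x => x 0 i) @^-1`
       [set r | `|r - ratr (z.1 0 i)| < z.2.+1%:R^-1]).
    by apply/seteqP; split => x /= Bx i; [move=> _|]; exact: Bx.
  apply: fin_bigcap_measurable => // i _; rewrite -[X in measurable X]setTI.
  apply: measurable_coor => //.
  rewrite (_ : [set r | _] = ball (ratr (z.1 0 i) : R) z.2.+1%:R^-1).
    apply: open_measurable; exact: ball_open.
  by apply/seteqP; split => r; rewrite /ball /= distrC.
have -> : A = \bigcup_(z in [set z | B z `<=` A]) B z.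
  apply/seteqP; split => [x Ax|x [z zA]]; last exact: zA.
  have /nbhs_ballP[e e0 xeA] : nbhs x A by exact: open_nbhs_nbhs.
  have [k _ ke] : \forall k \near \oo, k.+1%:R^-1 < e / 2.
    by apply: (near_infty_natSinv_lt (PosNum (divr_gt0 e0 (ltr0n _ 2)))).
  have k0 : (0 : R) < k.+1%:R^-1 by rewrite invr_gt0.
  have q_ i : {q : rat | `|x 0 i - ratr q| < k.+1%:R^-1}.
    apply: cid; have [q _] : exists2 q : rat, True &
        (ratr q : R) \in `](x 0 i - k.+1%:R^-1), (x 0 i + k.+1%:R^-1)[.
      have [|q qx] := @rat_in_itvoo R (x 0 i - k.+1%:R^-1) (x 0 i + k.+1%:R^-1).
        by rewrite ltrBlDr -addrA ltrDl addr_gt0.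
      by exists q.
    rewrite in_itv/= => /andP[q1 q2]; exists q.
    by rewrite distrC ltr_distl q1 q2.
  exists (\row_i sval (q_ i), k) => /=; last first.
    by move=> i /=; rewrite mxE; exact: (svalP (q_ i)).
  move=> y By; apply: xeA; split => // i j; rewrite ord1 /ball/=.
  have := By j; rewrite /= mxE => yj; have := svalP (q_ j) => xj.
  rewrite (le_lt_trans (ler_distD (ratr (sval (q_ j))) _ _))//.
  rewrite [X in _ + X]distrC (lt_le_trans (ltrD xj yj))//.
  by have /ltW := ke k (leqnn _); rewrite [e in _ -> _ <= e]splitr => kk; exact: lerD.
rewrite bigcup_mkcond; apply: countable_bigcupT_measurable => // z.
by case: ifP.
Qed.

Lemma continuous_measurable_rV (R : realType) n (f : 'rV[R]_n -> R) :
  continuous f -> measurable_fun [set: 'rV[R]_n] (f : _ -> measurableTypeR R).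
Proof.
move=> cf; apply: (measurability _ (RGenOpens.measurableE R)) => _ [_ [a [b ->]] <-].
rewrite setTI; apply: open_measurable_rV; apply: open_comp => //.
Qed.

Lemma measurable_mulmx (R : realType) m n (Q : 'M[R]_(m, n)) :
  measurable_fun [set: 'rV[R]_m] (fun x => x *m Q).
Proof.
apply: measurable_fun_rV => j.
rewrite (_ : (fun _ => _) = (fun x : 'rV[R]_m => \sum_i x 0 i * Q i j)); last first.
  by apply/funext => x; rewrite mxE.
apply: measurable_sum => i; apply: measurable_funM => //.
exact: measurable_coor.
Qed.

Lemma measurable_affine_rV (R : realType) n (c : 'rV[R]_n) (u : R) :
  measurable_fun [set: 'rV[R]_n] (fun x => c + u *: x).
Proof.
apply: measurable_fun_rV => j; under eq_fun do rewrite mxE mxE.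
apply: measurable_funD => //; apply: measurable_funM => //.
exact: measurable_coor.
Qed.

Definition image_measure d d' (T1 : measurableType d) (T2 : measurableType d')
    (R : realType) (m : {measure set T1 -> \bar R}) (f : T1 -> T2)
    (mf : measurable_fun [set: T1] f) : {measure set T2 -> \bar R} :=
  measure_function_pushforward__canonical__measure_function_Measure m mf.

(** The scaled image measure agrees with Lebesgue measure on the intervals ]a, b], which determine
    the latter. *)
Lemma lebesgue_measure_affine (R : realType) (c u : R) (A : set R) :
  u != 0 -> measurable A ->
  (`|u|%:E * lebesgue_measure ((fun x => c + u * x)%R @^-1` A) =
   lebesgue_measure A)%E.
Proof.
move=> u0 mA.
have mf : measurable_fun [set: measurableTypeR R]
    (fun x => c + u * x : measurableTypeR R).
  by apply: measurable_funD => //; exact: measurable_funM.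
apply/esym.
rewrite -[RHS]/(mscale (NngNum (normr_ge0 u))
  (image_measure (@lebesgue_measure R) mf) A).
apply: lebesgue_measure_unique => // _ [[a b] _ <-] /=.
rewrite /mscale /image_measure /= /pushforward.
have [ab|ba] := ltP a b; last first.
  by rewrite set_itv_ge ?bnd_simp -?leNgt// preimage_set0 !measure0 mule0.
rewrite lebesgue_measure_itv /= lte_fin ab.
have [u_gt0|u_lt0|/esym/eqP] := ltgtP 0 u; last by rewrite (negbTE u0).
- rewrite (_ : _ @^-1` _ = `]((a - c) / u), ((b - c) / u)]%classic).
    rewrite lebesgue_measure_itv /= lte_fin ltr_pM2r ?invr_gt0// ltrD2r ab.
    by rewrite -!EFinD -EFinM gtr0_norm//; congr (_%:E); field.
  apply/seteqP; split => x /=; rewrite !in_itv/= ltr_pdivrMr// ler_pdivlMr//.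
    by rewrite ltrBlDl lerBrDl mulrC.
  by rewrite ltrBlDl lerBrDl mulrC.
(* A negative factor exchanges the closed and open ends; the length is the same. *)
- rewrite (_ : _ @^-1` _ = `[((b - c) / u), ((a - c) / u)[%classic).
    rewrite lebesgue_measure_itv /= lte_fin ltr_nM2r ?invr_lt0// ltrD2r ab.
    by rewrite -!EFinD -EFinM ltr0_norm//; congr (_%:E); field.
  apply/seteqP; split => x /=; rewrite !in_itv/= ltr_ndivlMr// ler_ndivrMr//.
    by rewrite ltrBlDl lerBrDl mulrC andbC.
  by rewrite ltrBlDl lerBrDl mulrC andbC.
Qed.

Lemma lebesgue_rVS (R : realType) n (A : set 'rV[R]_n.+1) :
  (lebesgue_rV R n.+1 A = \int[lebesgue_measure]_s
     lebesgue_rV R n [set y | A (cons_rV (s, y))])%E.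
Proof.
rewrite /= /cons_measure /pushforward /product_measure1.
apply: eq_integral => s _ /=; congr (lebesgue_rV R n _).
by apply/seteqP; split => y; rewrite /xsection /= inE.
Qed.

Lemma cons_rV0 (R : realType) n (z : measurableTypeR R * 'rV[R]_n) :
  cons_rV z 0 0 = z.1.
Proof. by have := congr1 fst (cons_rVK z). Qed.

Lemma cons_rV_lift (R : realType) n (z : measurableTypeR R * 'rV[R]_n) i :
  cons_rV z 0 (lift 0 i) = z.2 0 i.
Proof.
by have := congr1 (fun w : _ * 'rV[R]_n => w.2 0 i) (cons_rVK z); rewrite /= mxE.
Qed.

Lemma eq_rVS (R : realType) n (x y : 'rV[R]_n.+1) :
  x 0 0 = y 0 0 -> (forall i, x 0 (lift 0 i) = y 0 (lift 0 i)) -> x = y.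
Proof.
by move=> h0 hS; apply/rowP => i; case: (unliftP 0 i) => [j|] ->.
Qed.

Lemma uncons_rVK (R : realType) n : cancel (@uncons_rV R n) (@cons_rV R n).
Proof. by move=> x; apply: eq_rVS => [|i]; rewrite ?cons_rV0 ?cons_rV_lift//= mxE. Qed.

Lemma cons_rV_affine (R : realType) n (c : 'rV[R]_n.+1) (u s : R) (y : 'rV[R]_n) :
  c + u *: cons_rV (s, y) =
  cons_rV ((uncons_rV c).1 + u * s, (uncons_rV c).2 + u *: y).
Proof.
apply: eq_rVS => [|i]; rewrite [LHS]mxE [X in _ + X = _]mxE.
  by rewrite !cons_rV0.
by rewrite !cons_rV_lift /= [RHS]mxE; congr (_ + _); rewrite mxE.
Qed.

Lemma measurable_lebesgue_slice (R : realType) n (A : set 'rV[R]_n.+1) :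
  measurable A -> measurable_fun [set: measurableTypeR R]
    (fun s => lebesgue_rV R n [set y | A (cons_rV (s, y))]).
Proof.
move=> mA.
have mcA : measurable (@cons_rV R n @^-1` A).
  rewrite -[X in measurable X]setTI; exact: (measurable_funP (@cons_rV R n)).
have := measurable_fun_xsection (lebesgue_rV R n) mcA.
congr measurable_fun; apply/funext => s /=; congr (lebesgue_rV R n _).
by apply/seteqP; split => y; rewrite /xsection /= inE.
Qed.

Lemma measurable_slice (R : realType) n (A : set 'rV[R]_n.+1) s :
  measurable A -> measurable [set y | A (cons_rV (s, y))].
Proof.
move=> mA.
have mcA : measurable (@cons_rV R n @^-1` A).
  rewrite -[X in measurable X]setTI; exact: (measurable_funP (@cons_rV R n)).
have := measurable_xsection s mcA; congr measurable.
by apply/seteqP; split => y; rewrite /xsection /= inE.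
Qed.

Lemma ge0_integral_affine (R : realType) (c u : R) (f : R -> \bar R) :
  u != 0 -> measurable_fun [set: measurableTypeR R] f -> (forall x, 0 <= f x)%E ->
  (`|u|%:E * \int[lebesgue_measure]_x f (c + u * x)%R =
   \int[lebesgue_measure]_x f x)%E.
Proof.
move=> u0 mf f0.
have ma : measurable_fun [set: measurableTypeR R]
    (fun x => c + u * x : measurableTypeR R).
  by apply: measurable_funD => //; exact: measurable_funM.
rewrite [RHS](eq_measure_integral (mscale (NngNum (normr_ge0 u))
  (image_measure (@lebesgue_measure R) ma))); last first.
  by move=> A mA _; apply/esym/lebesgue_measure_affine.
rewrite ge0_integral_mscale//; congr (_ * _)%E.
by rewrite [RHS]ge0_integral_pushforward.
Qed.

(** Induction on the dimension: an affine map of this kind acts separately on the first coordinate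
    and on each slice. In dimension 0 it is the identity of a single point. *)
Lemma lebesgue_rV_affine (R : realType) n (c : 'rV[R]_n) (u : R) (A : set 'rV[R]_n) :
  u != 0 -> measurable A ->
  ((`|u| ^+ n)%:E * lebesgue_rV R n ((fun x => c + u *: x)%R @^-1` A) =
   lebesgue_rV R n A)%E.
Proof.
move=> u0; elim: n c A => [|n IH] c A mA.
  rewrite expr0 mul1e /= !diracE; congr (_%:R%:E); congr (_ \in _ : nat).
  by apply/seteqP; split => x /=; rewrite !thinmx0.
rewrite !lebesgue_rVS exprSr EFinM -muleA.
have {}IH s : (lebesgue_rV R n [set y | A (cons_rV (((uncons_rV c).1 + u * s)%R, y))] =
  (`|u| ^+ n)%:E * lebesgue_rV R n [set y | ((fun x => c + u *: x)%R @^-1` A) (cons_rV (s, y))])%E.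
  rewrite -(IH (uncons_rV c).2); last exact: measurable_slice.
  congr (_ * lebesgue_rV R n _)%E.
  by apply/seteqP; split => y /=; rewrite cons_rV_affine.
rewrite -[RHS](@ge0_integral_affine R (uncons_rV c).1 u)//; last first.
  exact: measurable_lebesgue_slice.
under [in RHS]eq_integral do rewrite IH.
rewrite ge0_integralZl//; first by rewrite muleCA.
apply: measurable_lebesgue_slice; rewrite -[X in measurable X]setTI.
exact: measurable_affine_rV.
Qed.

Lemma ge0_integral_rV_affine (R : realType) n (c : 'rV[R]_n) (u : R)
    (f : 'rV[R]_n -> \bar R) :
  u != 0 -> measurable_fun [set: 'rV[R]_n] f -> (forall x, 0 <= f x)%E ->
  ((`|u| ^+ n)%:E * \int[lebesgue_rV R n]_x f (c + u *: x)%R =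
   \int[lebesgue_rV R n]_x f x)%E.
Proof.
move=> u0 mf f0.
have un0 : 0 <= `|u| ^+ n by rewrite exprn_ge0.
rewrite [RHS](eq_measure_integral (mscale (NngNum un0)
  (image_measure (lebesgue_rV R n) (measurable_affine_rV c u)))); last first.
  by move=> A mA _; apply/esym/lebesgue_rV_affine.
rewrite ge0_integral_mscale//; congr (_ * _)%E.
by rewrite [RHS]ge0_integral_pushforward//; exact: measurable_affine_rV.
Qed.

(** * Euclidean inner product and measurability of vector operations *)

Section dot_theory.
Context (R : realType) (n : nat).
Implicit Types u v w : 'rV[R]_n.

Lemma dotE u v : dot u v = (u *m v^T) 0 0.
Proof. by rewrite mxE; apply: eq_bigr => i _; rewrite mxE. Qed.

Lemma dotC u v : dot u v = dot v u.
Proof. by apply: eq_bigr => i _; rewrite mulrC. Qed.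

Lemma dotDr u v w : dot u (v + w) = dot u v + dot u w.
Proof. by rewrite /dot -big_split; apply: eq_bigr => i _; rewrite mxE mulrDr. Qed.

Lemma dotZr k u v : dot u (k *: v) = k * dot u v.
Proof. by rewrite /dot mulr_sumr; apply: eq_bigr => i _; rewrite mxE mulrCA. Qed.

Lemma dotNr u v : dot u (- v) = - dot u v.
Proof. by rewrite -scaleN1r dotZr mulN1r. Qed.

Lemma dot_ge0 u : 0 <= dot u u.
Proof. by apply: sumr_ge0 => i _; rewrite -expr2 sqr_ge0. Qed.

Lemma dot_eq0 u : dot u u = 0 -> u = 0.
Proof.
move=> /eqP; rewrite psumr_eq0; last by move=> i _; rewrite -expr2 sqr_ge0.
move=> /allP u0; apply/rowP => i; rewrite mxE; apply/eqP.
by have := u0 i (mem_index_enum i); rewrite mulf_eq0 orbb.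
Qed.

Lemma dot_orthogonal (Q : 'M[R]_n) u v :
  Q *m Q^T = 1%:M -> dot (u *m Q) (v *m Q) = dot u v.
Proof. by move=> QQ; rewrite !dotE trmx_mul -mulmxA (mulmxA Q) QQ mul1mx. Qed.

End dot_theory.

Section measurable_rV_ops.
Context d (T : measurableType d) (R : realType).

Lemma measurable_fun_coor n (f : T -> 'rV[R]_n) i :
  measurable_fun setT f ->
  measurable_fun setT (fun t => f t 0 i : measurableTypeR R).
Proof.
move=> mf; rewrite (_ : (fun _ => _) = (fun x : 'rV[R]_n => x 0 i) \o f)//.
by apply: measurableT_comp => //; exact: measurable_coor.
Qed.

Lemma measurable_fun_rVD n (f g : T -> 'rV[R]_n) :
  measurable_fun setT f -> measurable_fun setT g ->
  measurable_fun setT (fun t => f t + g t).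
Proof.
move=> mf mg; apply: measurable_fun_rV => i; under eq_fun do rewrite mxE.
by apply: measurable_funD; exact: measurable_fun_coor.
Qed.

Lemma measurable_fun_rVZ n (k : T -> measurableTypeR R) (f : T -> 'rV[R]_n) :
  measurable_fun setT k -> measurable_fun setT f ->
  measurable_fun setT (fun t => (k t : R) *: f t).
Proof.
move=> mk mf; apply: measurable_fun_rV => i; under eq_fun do rewrite mxE.
by apply: measurable_funM => //; exact: measurable_fun_coor.
Qed.

Lemma measurable_fun_rVN n (f : T -> 'rV[R]_n) :
  measurable_fun setT f -> measurable_fun setT (fun t => - f t).
Proof.
move=> mf; under eq_fun do rewrite -scaleN1r.
by apply: measurable_fun_rVZ => //; exact: measurable_cst.
Qed.

Lemma measurable_fun_rVM m n (Q : 'M[R]_(m, n)) (f : T -> 'rV[R]_m) :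
  measurable_fun setT f -> measurable_fun setT (fun t => f t *m Q).
Proof. by move=> mf; apply: (measurableT_comp (measurable_mulmx Q)). Qed.

Lemma measurable_fun_cons_rV n (s : T -> measurableTypeR R) (f : T -> 'rV[R]_n) :
  measurable_fun setT s -> measurable_fun setT f ->
  measurable_fun setT (fun t => cons_rV (s t, f t)).
Proof.
move=> ms mf; rewrite (_ : (fun _ => _) = @cons_rV R n \o (fun t => (s t, f t)))//.
apply: measurableT_comp; first exact: (measurable_funP (@cons_rV R n)).
exact: measurable_fun_pair.
Qed.

Lemma measurable_fun_dot n (f g : T -> 'rV[R]_n) :
  measurable_fun setT f -> measurable_fun setT g ->
  measurable_fun setT (fun t => dot (f t) (g t) : measurableTypeR R).
Proof.
move=> mf mg; apply: measurable_sum => i.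
by apply: measurable_funM; exact: measurable_fun_coor.
Qed.

Lemma measurable_preimage d' (T' : measurableType d') (f : T -> T') A :
  measurable_fun setT f -> measurable A -> measurable (f @^-1` A).
Proof. by move=> mf mA; rewrite -[X in measurable X]setTI; exact: mf. Qed.

End measurable_rV_ops.

(** * Invariance under translations, reflections and orthogonal maps *)

Section lebesgue_rV_invariance.
Context (R : realType).
Local Open Scope ereal_scope.

Lemma ge0_integral_rV_shift n (c : 'rV[R]_n) (f : 'rV[R]_n -> \bar R) :
  measurable_fun [set: 'rV[R]_n] f -> (forall x, 0 <= f x) ->
  \int[lebesgue_rV R n]_x f (c + x)%R = \int[lebesgue_rV R n]_x f x.
Proof.
move=> mf f0; rewrite -[RHS](@ge0_integral_rV_affine R n c 1)// normr1 expr1n mul1e.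
by apply: eq_integral => x _; rewrite scale1r.
Qed.

Lemma ge0_integral_rV_reflect n (c : 'rV[R]_n) (f : 'rV[R]_n -> \bar R) :
  measurable_fun [set: 'rV[R]_n] f -> (forall x, 0 <= f x) ->
  \int[lebesgue_rV R n]_x f (c - x)%R = \int[lebesgue_rV R n]_x f x.
Proof.
move=> mf f0; rewrite -[RHS](@ge0_integral_rV_affine R n c (-1)) ?oppr_eq0//.
  rewrite normrN1 expr1n mul1e.
  by apply: eq_integral => x _; rewrite scaleN1r.
Qed.

Let box n (r : R) : set 'rV[R]_n := [set x | forall i, `|x 0%R i|%R <= r]%R.

Let measurable_box n r : measurable (@box n r).
Proof.
have -> : @box n r = \bigcap_(i in [set: 'I_n])
    ((fun x => x 0%R i) @^-1` [set a | `|a| <= r]%R).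
  by apply/seteqP; split => x /= Bx i; [move=> _|]; exact: Bx.
apply: fin_bigcap_measurable => // i _; rewrite -[X in measurable X]setTI.
apply: measurable_coor => //.
rewrite (_ : [set a | _] = `[(- r)%R, r]%classic) //.
by apply/seteqP; split => a /=; rewrite in_itv/= ler_norml.
Qed.

Let lebesgue_box n (r : R) : (0 < r)%R -> lebesgue_rV R n (@box n r) = ((r + r) ^+ n)%:E.
Proof.
move=> r0; elim: n => [|n IH].
  by rewrite expr0 /= diracE mem_set// => -[].
rewrite lebesgue_rVS.
transitivity (\int[lebesgue_measure]_s
    (((r + r) ^+ n)%:E * (\1_(`[(- r)%R, r]%classic) s)%:E)).
  apply: eq_integral => s _; rewrite -IH indicE; have [sr|sr] := boolP (s \in _).
    rewrite mule1; congr (lebesgue_rV R n _).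
    move: sr; rewrite inE/= in_itv/= -ler_norml => sr.
    apply/seteqP; split => y /= yr i.
      by have := yr (lift 0%R i); rewrite cons_rV_lift.
    by case: (unliftP 0%R i) => [j|] ->; rewrite ?cons_rV_lift ?cons_rV0.
  rewrite mule0 (_ : [set y | _] = set0) ?measure0//.
  apply/seteqP; split => y //= yr; move: sr; rewrite notin_setE/= in_itv/= -ler_norml.
  by have := yr 0%R; rewrite cons_rV0.
rewrite ge0_integralZl//=; first last.
- by rewrite lee_fin exprn_ge0// addr_ge0// ltW.
- exact/measurable_EFinP/measurable_indic.
transitivity (((r + r) ^+ n)%:E * lebesgue_measure `[(- r)%R, r]%classic).
  by congr (_ * _); rewrite integral_indic//; congr (lebesgue_measure _); exact: setIT.
rewrite lebesgue_measure_itv/= lte_fin.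
by rewrite gtrN// -EFinD opprK -EFinM -exprSr.
Qed.

(** A reference set that every orthogonal map preserves; comparison with boxes shows that its
    measure is positive and finite, so that one can divide by it. *)
Let ball2 n : set 'rV[R]_n := [set x | (dot x x <= 1)%R].

Let measurable_ball2 n : measurable (@ball2 n).
Proof.
rewrite (_ : @ball2 n = (fun x => dot x x) @^-1` `]-oo, 1%R]%classic); last first.
  by apply/seteqP; split => x /=; rewrite in_itv.
rewrite -[X in measurable X]setTI.
by apply: (@measurable_fun_dot _ _ R n id id).
Qed.

Let lebesgue_ball2_gt0 n : 0 < lebesgue_rV R n (@ball2 n).
Proof.
(* With half-width 1/(n+1) the n squares add up to at most n/(n+1); the successor also covers
   dimension 0. *)
have r0 : (0 < n.+1%:R^-1 :> R)%R by rewrite invr_gt0.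
apply: (@lt_le_trans _ _ (lebesgue_rV R n (@box n n.+1%:R^-1))).
  by rewrite lebesgue_box// lte_fin exprn_gt0// addr_gt0.
apply: le_measure; rewrite ?inE//; [exact: measurable_box|exact: measurable_ball2|].
move=> x bx; rewrite /ball2/=.
apply: (@le_trans _ _ (\sum_(i < n) n.+1%:R^-1)%R).
  apply: ler_sum => i _; rewrite -expr2 -[leLHS]ger0_norm ?sqr_ge0//.
  rewrite (le_trans _ (bx i))// normrX expr2 ler_piMr// (le_trans (bx i))// invf_le1//.
  by rewrite ler1n.
rewrite sumr_const card_ord -[leLHS]mulr_natl ler_pdivrMr// mul1r ler_nat.
exact: leqnSn.
Qed.

Let lebesgue_ball2_fin n : lebesgue_rV R n (@ball2 n) \is a fin_num.
Proof.
rewrite ge0_fin_numE//; apply: (@le_lt_trans _ _ (lebesgue_rV R n (@box n 1))).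
  apply: le_measure; rewrite ?inE//; [exact: measurable_ball2|exact: measurable_box|].
  move=> x; rewrite /ball2/= => bx i.
  rewrite -(@ler_pXn2r _ 2)// ?nnegrE// expr1n -normrX ger0_norm ?sqr_ge0//.
  apply: le_trans bx; rewrite /dot (bigD1 i)//= -expr2 lerDl sumr_ge0// => j _.
  by rewrite -expr2 sqr_ge0.
by rewrite lebesgue_box// ltry.
Qed.

(* Tonelli's theorem shows that the measures of [A] and of its preimage are
   proportional to the measures of the Euclidean ball and of its preimage, and
   the latter two coincide. *)
Lemma lebesgue_rV_orthogonal n (Q : 'M[R]_n) A : Q *m Q^T = 1%:M -> measurable A ->
  lebesgue_rV R n ((fun x => x *m Q) @^-1` A) = lebesgue_rV R n A.
Proof.
move=> QQ mA; set mu := lebesgue_rV R n; set B := @ball2 n.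
have QtQ : Q^T *m Q = 1%:M by exact: mulmx1C.
pose a x : \bar R := (\1_A x)%:E; pose b x : \bar R := (\1_B x)%:E.
have ma : measurable_fun setT a by exact/measurable_EFinP/measurable_indic.
have mb : measurable_fun setT b.
  by apply/measurable_EFinP/measurable_indic; exact: measurable_ball2.
have a0 x : 0 <= a x by rewrite lee_fin.
have b0 x : 0 <= b x by rewrite lee_fin.
have intb : \int[mu]_x b x = mu B.
  by rewrite integral_indic ?setIT//; exact: measurable_ball2.
have inta : \int[mu]_x a x = mu A by rewrite integral_indic ?setIT.
have mQ : measurable_fun setT (fun x : 'rV[R]_n => x *m Q) by exact: measurable_mulmx.
have maQ : measurable_fun setT (fun x => a (x *m Q)) by exact: measurableT_comp.
have intaQ : \int[mu]_x a (x *m Q) = mu ((fun x => x *m Q) @^-1` A).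
  rewrite -(setIT (_ @^-1` A)) -integral_indic//; exact: measurable_preimage.
suff H : mu B * mu ((fun x => x *m Q) @^-1` A) = mu B * mu A.
  have := congr1 (fun z => (fine (mu B))^-1%:E * z) H.
  have mB0 : fine (mu B) != 0%R.
    by rewrite gt_eqF// fine_gt0// lebesgue_ball2_gt0 -ge0_fin_numE//; exact: lebesgue_ball2_fin.
  by rewrite -(fineK (lebesgue_ball2_fin n)) !muleA -!EFinM mulVf// !mul1e.
(* In this order, a shift of x by y Q^T turns the inner integral into the measure of the preimage.
   In the other order, a shift of y by x Q leaves 1_B(y - x Q) 1_A(y), and the x-integral of the
   first factor is the measure of the ball. *)
transitivity (\int[mu]_y \int[mu]_x (b y * a (y + x *m Q)%R)).
  rewrite -intb -ge0_integralZr//.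
  apply: eq_integral => y _; rewrite ge0_integralZl//; first last.
    apply: measurableT_comp => //; apply: measurable_fun_rVD => //.
  congr (_ * _); rewrite -intaQ -(@ge0_integral_rV_shift n (y *m Q^T))//.
  by apply: eq_integral => x _; rewrite mulmxDl -mulmxA QtQ mulmx1.
have mba : measurable_fun setT
    (fun z : 'rV[R]_n * 'rV[R]_n => b z.1 * a (z.1 + z.2 *m Q)%R).
  apply: emeasurable_funM; first exact: measurableT_comp.
  apply: measurableT_comp => //; apply: measurable_fun_rVD => //.
  exact: measurable_fun_rVM.
rewrite (fubini_tonelli (fun z : 'rV[R]_n * 'rV[R]_n => b z.1 * a (z.1 + z.2 *m Q)%R))//=; last first.
  by move=> z; rewrite mule_ge0.
transitivity (\int[mu]_x \int[mu]_y (b (y - x *m Q)%R * a y)).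
  apply: eq_integral => x _.
  rewrite -(@ge0_integral_rV_shift n (x *m Q) (fun y => b (y - x *m Q)%R * a y)).
  - by apply: eq_integral => y _; rewrite addrAC subrr add0r [(x *m Q + y)%R]addrC.
  - apply: emeasurable_funM => //; apply: measurableT_comp => //.
    exact: measurable_fun_rVD.
  - by move=> y; rewrite mule_ge0.
rewrite (fubini_tonelli (fun z : 'rV[R]_n * 'rV[R]_n => b (z.2 - z.1 *m Q)%R * a z.2))/=; first last.
  by move=> z; rewrite mule_ge0.
  apply: emeasurable_funM; last exact: measurableT_comp.
  apply: measurableT_comp => //; apply: measurable_fun_rVD => //.
  by apply: measurable_fun_rVN; exact: measurable_fun_rVM.
rewrite -inta -ge0_integralZl//.
apply: eq_integral => y _; rewrite ge0_integralZr//; last first.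
  apply: measurableT_comp => //; apply: measurable_fun_rVD => //.
  exact: measurable_fun_rVN.
congr (_ * _).
have mbQ : measurable_fun setT (fun x : 'rV[R]_n => b (y - x *m Q)%R).
  apply: measurableT_comp => //; apply: measurable_fun_rVD => //.
  exact: measurable_fun_rVN.
rewrite -(@ge0_integral_rV_reflect n (y *m Q^T) _ mbQ)// -intb.
apply: eq_integral => x _; rewrite mulmxBl -mulmxA QtQ mulmx1 subKr.
congr (_%:R%:E); congr nat_of_bool.
by apply/idP/idP; rewrite !inE /B /ball2 /= dot_orthogonal.
Qed.

End lebesgue_rV_invariance.

(** * Sets that are null along a direction, and hyperplanes *)

Section null_sets.
Context (R : realType).
Local Open Scope ereal_scope.

Lemma measurable_line n (Z : set 'rV[R]_n) (x e : 'rV[R]_n) : measurable Z ->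
  measurable [set t : measurableTypeR R | Z (x + t *: e)%R].
Proof.
move=> mZ.
have mf : measurable_fun [set: measurableTypeR R] (fun t => x + (t : R) *: e)%R.
  apply: measurable_fun_rVD; first exact: measurable_cst.
  by apply: measurable_fun_rVZ => //; exact: measurable_cst.
by rewrite -[X in measurable X]setTI; exact: mf.
Qed.

(* Averaging the translates of [Z] along [e] and exchanging the integrals. *)
Lemma lebesgue_rV_null_direction n (Z : set 'rV[R]_n) (e : 'rV[R]_n) :
  measurable Z ->
  (forall x, lebesgue_measure [set t : R | Z (x + t *: e)%R] = 0) ->
  lebesgue_rV R n Z = 0.
Proof.
move=> mZ Z0; set mu := lebesgue_rV R n.
pose z x : \bar R := (\1_Z x)%:E.
pose i01 (t : measurableTypeR R) : \bar R := (\1_(`[0%R, 1%R]%classic) t)%:E.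
have mz : measurable_fun setT z by exact/measurable_EFinP/measurable_indic.
have mi : measurable_fun setT i01 by exact/measurable_EFinP/measurable_indic.
have z0 x : 0 <= z x by rewrite lee_fin.
have i0 t : 0 <= i01 t by rewrite lee_fin.
have intz : \int[mu]_x z x = mu Z by rewrite integral_indic ?setIT.
have inti : \int[lebesgue_measure]_t i01 t = 1.
  transitivity (lebesgue_measure (`[0%R, 1%R]%classic : set R)).
    by rewrite integral_indic//; congr (lebesgue_measure _); exact: setIT.
  by rewrite lebesgue_measure_itv/= lte_fin ltr01 -EFinD subr0.
have mxt d (T : measurableType d) (f : T -> 'rV[R]_n) (g : T -> measurableTypeR R) :
    measurable_fun setT f -> measurable_fun setT g ->
    measurable_fun setT (fun u => z ((g u : R) *: e + f u)%R).
  move=> mf mg; apply: measurableT_comp => //; apply: measurable_fun_rVD => //.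
  by apply: measurable_fun_rVZ => //; exact: measurable_cst.
transitivity (\int[lebesgue_measure]_t \int[mu]_x (i01 t * z ((t : R) *: e + x)%R)).
  rewrite -[LHS]mul1e -inti -intz -ge0_integralZr//; last exact: integral_ge0.
  apply: eq_integral => t _; rewrite ge0_integralZl//; last by apply: mxt => //; exact: measurable_cst.
  by rewrite ge0_integral_rV_shift.
rewrite (fubini_tonelli (fun w : measurableTypeR R * 'rV[R]_n =>
  i01 w.1 * z ((w.1 : R) *: e + w.2)%R))/=; first last.
  by move=> w; rewrite mule_ge0.
  by apply: emeasurable_funM; [exact: measurableT_comp|exact: mxt].
apply: integral0_eq => x _; apply/eqP; rewrite eq_le; apply/andP; split; last first.
  by apply: integral_ge0 => t _; rewrite mule_ge0.
have mt : measurable_fun setT (fun t : measurableTypeR R => z ((t : R) *: e + x)%R).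
  by apply: mxt => //; exact: measurable_cst.
apply: (@le_trans _ _ (\int[lebesgue_measure]_t z ((t : R) *: e + x)%R)).
  apply: ge0_le_integral => //.
  - by move=> t _; rewrite mule_ge0.
  - exact: emeasurable_funM.
  - by move=> t _; rewrite gee_pMl// lee_fin indicE; case: (_ \in _).
have mZx : measurable [set t : measurableTypeR R | Z (x + t *: e)%R].
  exact: measurable_line.
have -> : \int[lebesgue_measure]_t z ((t : R) *: e + x)%R =
    \int[lebesgue_measure]_t (\1_[set t : measurableTypeR R | Z (x + t *: e)%R] t)%:E.
  apply: eq_integral => t _; congr (_%:R%:E); congr nat_of_bool.
  by apply/idP/idP; rewrite !inE/= addrC.
rewrite integral_indic// -[leRHS](Z0 x) le_eqVlt; apply/orP; left; apply/eqP.
by congr (lebesgue_measure _); exact: setIT.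
Qed.

(** Every line directed by the normal [a] meets the hyperplane in at most one point, since dot a a
    is not 0. *)
Lemma lebesgue_rV_hyperplane n (a x0 : 'rV[R]_n) : a != 0%R ->
  measurable (hyperplane a x0) /\ lebesgue_rV R n (hyperplane a x0) = 0.
Proof.
move=> a0.
have mH : measurable (hyperplane a x0).
  rewrite (_ : hyperplane a x0 = (fun x => dot a (x - x0)%R) @^-1` [set 0%R])//.
  have mf : measurable_fun [set: 'rV[R]_n]
      (fun x => dot a (x - x0)%R : measurableTypeR R).
    by apply: measurable_fun_dot => //; exact: measurable_fun_rVD.
  by rewrite -[X in measurable X]setTI; exact: mf.
split => //; apply: (@lebesgue_rV_null_direction _ _ a) => // x.
have aa0 : (dot a a != 0)%R by apply: contra a0 => /eqP/dot_eq0 ->.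
apply/eqP; rewrite eq_le measure_ge0 andbT.
rewrite -(lebesgue_measure_set1 (- dot a (x - x0) / dot a a)%R).
apply: le_measure; rewrite ?inE.
- exact: measurable_line.
- exact: measurable_set1.
- move=> t; rewrite /= /hyperplane/= addrAC dotDr dotZr => /eqP.
  by rewrite addr_eq0 => /eqP ->; rewrite opprK mulfK.
Qed.

End null_sets.

(** * The reproducing kernel at 1 for the weight t^(d-1) *)

Section radial_moments.
Context (F : realFieldType) (d : nat).
Hypothesis d_gt0 : (0 < d)%N.
Implicit Types q r : {poly F}.

(** The integral of q(t) t^(d-1) over [0, 1], taken term by term; in this algebraic form the
    reproducing property is a finite linear system. *)
Definition radial_moment q : F := \sum_(i < size q) q`_i / (i + d)%:R.

Lemma radial_momentE N q : (size q <= N)%N ->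
  radial_moment q = \sum_(i < N) q`_i / (i + d)%:R.
Proof.
move=> qN; rewrite /radial_moment (big_ord_widen N (fun i => q`_i / (i + d)%:R))//.
rewrite [RHS](bigID (fun i : 'I_N => (i < size q)%N))/= [X in _ = _ + X]big1 ?addr0//.
by move=> i; rewrite -leqNgt => qi; rewrite nth_default// mul0r.
Qed.

Lemma radial_moment_is_linear : linear_for *%R radial_moment.
Proof.
move=> a q r; pose N := maxn (size q) (size r).
have qN : (size q <= N)%N by exact: leq_maxl.
have rN : (size r <= N)%N by exact: leq_maxr.
rewrite (radial_momentE qN) (radial_momentE rN) (@radial_momentE N); last first.
  by rewrite (leq_trans (size_polyD _ _))// geq_max rN (leq_trans (size_scale_leq _ _)).
rewrite mulr_sumr -big_split/=; apply: eq_bigr => i _.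
by rewrite coefD coefZ mulrDl mulrA.
Qed.

HB.instance Definition _ := GRing.isLinear.Build F {poly F} F *%R radial_moment
  radial_moment_is_linear.

Lemma radial_momentXn k : radial_moment 'X^k = (k + d)%:R^-1.
Proof.
rewrite (@radial_momentE k.+1) ?size_polyXn// big_ord_recr/= big1 ?add0r.
  by rewrite coefXn eqxx mul1r.
by move=> i _; rewrite coefXn ltn_eqF ?mul0r.
Qed.

(* The coefficients of the reproducing kernel solve a Cauchy linear system: they
   are the residues of 1 - \prod_k (X - k) / \prod_j (X + j + d). *)
Lemma reproducing_kernel p : exists k : {poly F},
  [/\ (size k <= p.+1)%N, k.[1] = ((p + 1) * (p + d))%:R &
      forall w : {poly F}, (size w <= p.+1)%N -> radial_moment (w * k) = w.[1]].
Proof.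
pose c (j : nat) : F := - (j + d)%:R.
pose A := \prod_(j < p.+1) ('X - (c j)%:P).
pose B : {poly F} := \prod_(j < p.+1) ('X - (j : nat)%:R%:P).
pose L (j : 'I_p.+1) := \prod_(i < p.+1 | i != j) ('X - (c i)%:P).
pose a (j : 'I_p.+1) := (A - B).[c j] / (L j).[c j].
have c_inj : injective c.
  by move=> i j /oppr_inj/eqP; rewrite eqr_nat eqn_add2r => /eqP.
have AL (j : 'I_p.+1) : A = ('X - (c j)%:P) * L j by rewrite /A (bigD1 j).
have sA : size A = p.+2.
  by rewrite size_prod_XsubC /index_enum -enumT size_enum_ord.
have sB : size B = p.+2.
  by rewrite size_prod_XsubC /index_enum -enumT size_enum_ord.
have mA : A \is monic by exact: monic_prod_XsubC.
have mB : B \is monic by exact: monic_prod_XsubC.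
have mL j : L j \is monic by exact: monic_prod_XsubC.
have sL j : size (L j) = p.+1.
  have := sA; rewrite (AL j) size_monicM ?monicXsubC ?monic_neq0//.
  by rewrite size_XsubC /= => -[].
have sAB : (size (A - B)%R <= p.+1)%N.
  apply/leq_sizeP => i; rewrite leq_eqVlt => /orP[/eqP <-|pi].
    move: mA mB; rewrite !monicE /lead_coef sA sB /= => /eqP A1 /eqP B1.
    by rewrite coefB A1 B1 subrr.
  by rewrite coefB !nth_default ?subr0// ?sA ?sB.
have Lij (i j : 'I_p.+1) : i != j -> (L j).[c i] = 0.
  by move=> ij; rewrite horner_prod (bigD1 i)//= hornerXsubC subrr mul0r.
have Lj0 j : (L j).[c j] != 0.
  rewrite horner_prod; apply/prodf_neq0 => i ij.
  by rewrite hornerXsubC subr_eq0 (inj_eq c_inj) eq_sym.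
(* Lagrange interpolation at the p + 1 roots of [A]: the leading terms cancel in A - B, whose degree
   is thus at most p. *)
have ABE : A - B = \sum_(j < p.+1) a j *: L j.
  apply/eqP; rewrite -subr_eq0; apply/eqP.
  apply: (@roots_geq_poly_eq0 _ _ [seq c i | i <- iota 0 p.+1]).
  - apply/allP => _ /mapP[i + ->]; rewrite mem_iota add0n => /= ip.
    pose i' := Ordinal ip.
    rewrite /root hornerD hornerN horner_sum (bigD1 i')//= hornerZ.
    rewrite /a -/(c i') divfK// big1 ?addr0 ?subrr// => j ji.
    by rewrite hornerZ -/(c i') (Lij i') ?mulr0// eq_sym.
  - by rewrite map_inj_uniq ?iota_uniq.
  - rewrite size_map size_iota (leq_trans (size_polyD _ _))// geq_max sAB size_polyN.
    apply: (leq_trans (size_sum _ _ _)); apply/bigmax_leqP => j _.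
    by rewrite (leq_trans (size_scale_leq _ _))// sL.
pose k := \poly_(j < p.+1) a (inord j).
have kE : k = \sum_(j < p.+1) a j *: 'X^j.
  by rewrite /k poly_def; apply: eq_bigr => j _; rewrite inord_val.
exists k; split; first exact: size_poly.
(* Each [L j] is monic of degree p, so the sum of the residues is the coefficient of X^p in A - B.
   By Vieta it is the sum of (j + d) + j over j <= p. *)
- transitivity ((A - B)`_p).
    rewrite ABE coef_sum kE horner_sum; apply: eq_bigr => j _.
    rewrite hornerZ hornerXn expr1n coefZ; congr (_ * _).
    by have := mL j; rewrite monicE /lead_coef sL => /eqP.
  have pA : A = \prod_(x <- [seq c i | i <- iota 0 p.+1]) ('X - x%:P).
    by rewrite big_map -[iota _ _]/(index_iota 0 p.+1) big_mkord.
  have pB : B = \prod_(x <- [seq i%:R | i <- iota 0 p.+1]) ('X - x%:P).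
    by rewrite big_map -[iota _ _]/(index_iota 0 p.+1) big_mkord.
  have := @coefPn_prod_XsubC _ [seq c i | i <- iota 0 p.+1].
  have := @coefPn_prod_XsubC F [seq i%:R | i <- iota 0 p.+1].
  rewrite -pA -pB !size_map !size_iota coefB => -> // -> //.
  rewrite !big_map -[iota _ _]/(index_iota 0 p.+1) !big_mkord opprK -sumrN -big_split/=.
  under eq_bigr do rewrite /c opprK -natrD.
  rewrite -natr_sum; congr _%:R.
  elim: (p) => [|m IH]; first by rewrite big_ord_recr/= ?big_ord0; lia.
  by rewrite big_ord_recr/= IH; lia.
- have Ak (i : nat) : A.[i%:R] != 0.
    rewrite horner_prod; apply/prodf_neq0 => j _.
    by rewrite hornerXsubC /c opprK -natrD pnatr_eq0 -lt0n !addn_gt0 d_gt0 !orbT.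
  (* Dividing the interpolation formula by [A] and evaluating at i <= p, a root of [B], gives the
     equation that says that X^i is reproduced. *)
  have moment (i : nat) : (i < p.+1)%N -> \sum_(j < p.+1) a j / (i + j + d)%:R = 1.
    move=> ip; have := congr1 (fun q => q.[i%:R] / A.[i%:R]) ABE.
    rewrite hornerD hornerN (_ : B.[_] = 0); last first.
      by rewrite horner_prod (bigD1 (Ordinal ip))//= hornerXsubC subrr mul0r.
    rewrite subr0 divff// => e1; rewrite [RHS]e1 horner_sum mulr_suml; apply: eq_bigr => j _.
    rewrite hornerZ -mulrA; congr (_ * _); have := Ak i; rewrite (AL j) hornerM.
    rewrite hornerXsubC /c opprK mulf_eq0 negb_or => /andP[h1 h2].
    by rewrite invfM mulrCA divff// mulr1 -natrD addnA.
  move=> w sw; have wE : w = \sum_(i < p.+1) w`_i *: 'X^i.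
    rewrite -(poly_def p.+1 (fun i => w`_i)); apply/polyP => i; rewrite coef_poly.
    by case: ltnP => // pi; rewrite nth_default// (leq_trans sw).
  rewrite (horner_coef_wide 1 sw) [in LHS]wE mulr_suml linear_sum/=.
  apply: eq_bigr => i _; rewrite -scalerAl linearZ/= expr1n; congr (_ * _).
  rewrite kE mulr_sumr linear_sum/= -[RHS](moment i)//; apply: eq_bigr => j _.
  by rewrite -scalerAr -exprD linearZ/= radial_momentXn.
Qed.

End radial_moments.

(** * The inverse inequality on a ray *)

Section radial_inequality.
Context (R : realType) (n : nat).

(** Here [n] is d - 1, hence [n.+1] on the right; [P] is the antiderivative of q t^n that vanishes
    at 0. *)
Lemma integral_radial_moment (q : {poly R}) :
  (\int[lebesgue_measure]_(t in `[0%R, 1%R]) (q.[t] * t ^+ n)%:E =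
   (radial_moment n.+1 q)%:E)%E.
Proof.
pose P : {poly R} := \sum_(i < size q) (q`_i / (i + n.+1)%:R) *: 'X^(i + n.+1).
have dP : P^`() = q * 'X^n.
  rewrite /P linear_sum/= -[q in RHS]coefK poly_def mulr_suml; apply: eq_bigr => i _.
  by rewrite linearZ/= derivXn -[X in _ *: X]scaler_nat scalerA divfK ?pnatr_eq0 ?addnS// -scalerAl -exprD.
rewrite (@continuous_FTC2 _ _ (horner P) 0 1)//.
- have -> : P.[1] = radial_moment n.+1 q.
    by rewrite horner_sum; apply: eq_bigr => i _; rewrite hornerZ hornerXn expr1n mulr1.
  have -> : P.[0] = 0.
    by rewrite horner_sum big1// => i _; rewrite hornerZ hornerXn addnS expr0n mulr0.
  by rewrite -EFinB subr0.
- apply: continuous_subspaceT => x.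
  rewrite (_ : (fun _ => _) = horner (q * 'X^n)); first exact: continuous_horner.
  by apply/funext => t; rewrite hornerM hornerXn.
- split; [by move=> x _; exact: derivable_horner| |].
  + exact/cvg_at_right_filter/continuous_horner.
  + exact/cvg_at_left_filter/continuous_horner.
- by move=> x _; rewrite -derivE dP hornerM hornerXn.
Qed.

Lemma radial_moment_sqr_ge0 (q : {poly R}) : 0 <= radial_moment n.+1 (q * q).
Proof.
rewrite -lee_fin -integral_radial_moment; apply: integral_ge0 => t /=.
rewrite in_itv/= => /andP[t0 _]; rewrite lee_fin hornerM -expr2.
by rewrite mulr_ge0 ?sqr_ge0 ?exprn_ge0.
Qed.

(** Cauchy-Schwarz between w and the kernel k: the moments of w k and of k k are w(1) and k(1) = C.
    Positivity is used at w - c k for the optimal c = w(1) / C. *)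
Lemma radial_inverse_inequality p (w : {poly R}) : (size w <= p.+1)%N ->
  w.[1] ^+ 2 <= ((p + 1) * (p + n.+1))%:R * radial_moment n.+1 (w * w).
Proof.
move=> sw; have [k [sk k1 kw]] := @reproducing_kernel R n.+1 isT p.
set C : R := _%:R in k1 *.
have C0 : 0 < C by rewrite ltr0n muln_gt0 !addnS.
pose c := w.[1] / C.
have := radial_moment_sqr_ge0 (w - c *: k).
have -> : (w - c *: k) * (w - c *: k) =
    w * w - (2 * c) *: (w * k) + (c ^+ 2) *: (k * k).
  by rewrite -!mul_polyC; ring.
rewrite linearD linearB/= !linearZ/= !kw// k1 scalerN => H.
have E : w.[1] = c * C by rewrite /c divfK// gt_eqF.
rewrite E exprMn; have : 0 <= C * (radial_moment n.+1 (w * w) - 2 * c * w.[1] + c ^+ 2 * C).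
  by rewrite mulr_ge0//; exact: ltW.
rewrite E; nra.
Qed.

(** Substituting x_i + e_i X for the variables turns a monomial of total degree m into a polynomial
    of degree at most m. *)
Lemma poly_space_line m p (v : 'rV[R]_m -> R) (x e : 'rV[R]_m) : poly_space p v ->
  exists2 w : {poly R}, (size w <= p.+1)%N & forall t, v (x + t *: e) = w.[t].
Proof.
move=> [q sq ->]; pose h i : {poly R} := (x 0 i)%:P + (e 0 i) *: 'X.
exists (mpoly.mmap polyC h q).
  rewrite /mpoly.mmap; apply: (leq_trans (size_sum _ _ _)).
  rewrite big_seq; elim/big_ind: _ => // [a b|a qa]; first by rewrite geq_max => -> ->.
  rewrite mul_polyC (leq_trans (size_scale_leq _ _))//.
  apply: leq_trans (leq_trans (mpoly.msize_mdeg_lt qa) sq).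
  rewrite mpoly.mdegE /mpoly.mmap1.
  elim/big_rec2: _ => [|i y1 y2 _ IH]; first by rewrite size_poly1.
  rewrite (leq_trans (size_polyMleq _ _))//.
  have hi : (size (h i ^+ a i) <= (a i).+1)%N.
    rewrite (leq_trans (size_poly_exp_leq _ _))// ltnS.
    rewrite -[leqRHS]mul1n leq_mul2r; apply/orP; right.
    rewrite -subn1 leq_subLR (leq_trans (size_polyD _ _))// geq_max.
    rewrite (leq_trans (size_polyC_leq1 _))//.
    by rewrite (leq_trans (size_scale_leq _ _))// size_polyX.
  by rewrite -subn1 leq_subLR (leq_trans (leq_add hi IH))// addSn addnS.
move=> t; rewrite mpoly.mevalE /mpoly.mmap horner_sum; apply: eq_bigr => a _.
rewrite hornerM hornerC; congr (_ * _); rewrite /mpoly.mmap1 horner_prod.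
by apply: eq_bigr => i _; rewrite horner_exp !hornerE !mxE mulrC.
Qed.

End radial_inequality.

(** * Integral of a derivative against the measure of the image *)

Section one_dimensional_area_formula.
Context (R : realType).
Implicit Types (T S G : set R) (s r ds : R -> R).
Local Notation mu := (@lebesgue_measure R).
Local Notation I01 := (`]0%R, 1%R[%classic : set R).
Local Open Scope ereal_scope.

Lemma lebesgue_measure_le_diameter G l : measurable G -> (0 <= l)%R ->
  (forall t t', G t -> G t' -> t' <= t + l)%R -> mu G <= l%:E.
Proof.
move=> mG l0 Gl; have [->|/set0P[g Gg]] := eqVneq G set0; first by rewrite measure0 lee_fin.
have lbG t : G t -> lbound G (t - l)%R by move=> Gt t' Gt'; rewrite lerBlDr; exact: Gl.
have hiG : has_inf G by split; [exists g|exists (g - l)%R; exact: lbG].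
apply: (@le_trans _ _ (mu `[inf G, (inf G + l)%R]%classic)).
  apply: le_measure; rewrite ?inE//.
  move=> t Gt; rewrite /= in_itv/= ge_inf//=; last by case: hiG.
  by rewrite -lerBlDr; apply: lb_le_inf; [exists g|exact: lbG].
rewrite lebesgue_measure_itv/= lte_fin; case: ifPn => _; last by rewrite lee_fin.
by rewrite -EFinD addrAC subrr add0r.
Qed.

(** The measure of [Y] unfolds to an infimum over covers by intervals. As [s] stretches by at least
    [a], the points of [T] sent into an interval of length l form a set of diameter at most l /
    a. *)
Lemma lebesgue_measure_expanding T Y s (a : R) : (0 < a)%R ->
  measurable T -> measurable_fun T s ->
  (forall t, T t -> Y (s t)) ->
  (forall t t', T t -> T t' -> t <= t' -> a * (t' - t) <= s t' - s t)%R ->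
  a%:E * mu T <= mu Y.
Proof.
move=> a0 mT ms TY sa.
rewrite [leRHS]/lebesgue_measure /lebesgue_stieltjes_measure /measure_extension /mu_ext.
apply: le_ereal_inf_tmp => _ [F [mF YF] <-].
pose G k := T `&` s @^-1` (F k).
have mFk k : measurable (F k : set (measurableTypeR R)).
  by apply: sub_sigma_algebra; exact: mF.
have mG k : measurable (G k) by apply: ms => //; exact: mFk.
have Gk k : mu (G k) <= (a^-1)%:E * wlength idfun (F k).
  have [[x y] /= _ xyF] := mF k; have [xy|yx] := ltP x y; last first.
    rewrite (_ : G k = set0) ?measure0 ?mule_ge0 ?lee_fin ?invr_ge0 ?(ltW a0) ?wlength_ge0//.
    apply/seteqP; split => t // -[_]; rewrite /= -xyF/= in_itv/= => /andP[xt ty].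
    by have := lt_le_trans xt ty; rewrite ltNge yx.
  rewrite -xyF wlength_itv_bnd ?(ltW xy)// -EFinM.
  apply: lebesgue_measure_le_diameter => //.
    by rewrite mulr_ge0 ?invr_ge0 ?(ltW a0)// subr_ge0 ltW.
  move=> t t' [Tt]; rewrite /= -xyF/= in_itv/= => /andP[xt ty].
  move=> [Tt']; rewrite /= -xyF/= in_itv/= => /andP[xt' ty'].
  have [tt'|t't] := leP t t'; last first.
    rewrite (le_trans (ltW t't))// lerDl mulr_ge0 ?invr_ge0 ?(ltW a0)//.
    by rewrite subr_ge0 ltW.
  rewrite -lerBlDl ler_pdivlMl// (le_trans (sa _ _ Tt Tt' tt'))//.
  by rewrite lerB// ltW.
have : mu T <= (a^-1)%:E * \sum_(0 <= k <oo) wlength idfun (F k).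
  rewrite -nneseriesZl; last by move=> k _; exact: wlength_ge0.
  apply: (@le_trans _ _ (\sum_(0 <= k <oo) mu (G k))).
    apply: measure_sigma_subadditive => // t Tt.
    by have [k _ Fk] := YF _ (TY _ Tt); exists k.
  by apply: lee_nneseries.
by rewrite -(lee_pmul2l _ (_ : 0 < a%:E)) ?lte_fin// muleA -EFinM divff ?gt_eqF// mul1e.
Qed.

(** The lower half of the first-order expansion; the difference quotient is multiplied by (t' - t)^2
    so that one inequality serves on both sides of t. *)
Lemma is_derive1_near s (t d : R) : is_derive t 1%R s d ->
  forall e : R, (0 < e)%R -> exists2 k, (0 < k)%R &
    forall t', (`|t' - t| < k -> (d - e) * (t' - t) ^+ 2 <= (s t' - s t) * (t' - t))%R.
Proof.
move=> [ds dE] e e0; move: ds; rewrite /derivable => /cvg_ex[l sl].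
have {dE} ld : l = d by rewrite -dE; exact/esym/cvg_lim.
move: sl; rewrite {l}ld => /cvgrPdist_lt/(_ _ e0)/nbhs_ballP[k/= k0 H].
exists k => // t' tt'; have [->|t't] := eqVneq t' t; first by rewrite subrr expr0n !mulr0.
have h0 : (t' - t != 0)%R by rewrite subr_eq0.
have := H (t' - t)%R; rewrite /ball/= sub0r normrN => /(_ tt' h0).
rewrite /shift/= scaler1 subrK => /ltW; rewrite ler_distlC => /andP[+ _].
have h2 : (0 < (t' - t) ^+ 2)%R by rewrite exprn_even_gt0.
rewrite -(ler_pM2r h2) => /le_trans; apply.
rewrite expr2 /GRing.scale/= mulrACA mulVf// mul1r//.
Qed.

Let expanding_set s (a : R) (k : nat) : set R :=
  [set t | I01 t /\ (forall t', I01 t' ->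
    `|t' - t| < k.+1%:R^-1 -> a * (t' - t) ^+ 2 <= (s t' - s t) * (t' - t))%R].

(** The complement in ]0, 1[ is a union over t' of sets that are open by continuity of [s]; being
    open, this uncountable union is measurable. *)
Let measurable_expanding_set s a k : {in `]0%R, 1%R[, continuous s} ->
  measurable (expanding_set s a k).
Proof.
move=> cs.
pose B := \bigcup_(t' in I01) (I01 `&`
  [set t | `|t' - t| < k.+1%:R^-1 /\ (s t' - s t) * (t' - t) - a * (t' - t) ^+ 2 < 0]%R).
have -> : expanding_set s a k = I01 `\` B.
  apply/seteqP; split => [t [t01 tP]|t [t01 tB]]; split => //.
    move=> [t' t'01 [_ [tt' H]]]; have := tP _ t'01 tt'.
    by rewrite leNgt -subr_lt0 H.
  move=> t' t'01 tt'; rewrite leNgt; apply/negP => H; apply: tB.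
  by exists t' => //; split => //; split => //; rewrite subr_lt0.
apply: measurableD => //; apply: open_measurable.
apply: bigcup_open => t' _; rewrite openE => t [/= t01 [tt' H]].
have ct : {for t, continuous s} by apply: cs.
have ctt : (fun u => t' - u)%R @ t --> (t' - t)%R.
  by apply: cvgB; [exact: cvg_cst|exact: cvg_id].
apply: filterI; first exact: (near_in_itvoo t01).
apply: filterI.
  have : (fun u => `|t' - u|)%R @ t --> `|t' - t|%R by exact: cvg_norm.
  by move=> /cvgr_lt; apply.
have : (fun u => (s t' - s u) * (t' - u) - a * (t' - u) ^+ 2)%R @ t -->
   ((s t' - s t) * (t' - t) - a * (t' - t) ^+ 2)%R.
  apply: cvgB; first by apply: cvgM => //; apply: cvgB => //; exact: cvg_cst.
  by apply: cvgM; [exact: cvg_cst|rewrite expr2; apply: cvgM].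
by move=> /cvgr_lt; apply.
Unshelve. all: end_near. Qed.

Section area.
Variables (T S : set R) (s r ds : R -> R).
Hypothesis mT : measurable T.
Hypothesis T01 : T `<=` I01.
Hypothesis mS : measurable S.
Hypothesis mr : measurable_fun setT r.
Hypothesis cs : {in `]0%R, 1%R[, continuous s}.
Hypothesis mds : measurable_fun T ds.
Hypothesis ds0 : forall t, T t -> (0 <= ds t)%R.
Hypothesis sds : forall t, T t -> is_derive t 1%R s (ds t).
Hypothesis rs : forall t, T t -> r (s t) = t.
Hypothesis TS : forall t, T t -> S (s t).

(** For [D] inside [T] this is the image of [D] by [s]; expressed with the left inverse [r] it is
    visibly measurable. *)
Let Y (D : set R) := [set x | D (r x) /\ s (r x) = x].

Let ms : measurable_fun I01 s.
Proof. by apply: open_continuous_measurable_fun => // x /[1!inE]; exact: cs. Qed.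

Let mY D : measurable D -> D `<=` T -> measurable (Y D).
Proof.
move=> mD DT.
have mrD : measurable (r @^-1` D) by rewrite -[X in measurable X]setTI; exact: mr.
have -> : Y D = (r @^-1` D) `&` (fun x => s (r x) - x)%R @^-1` [set 0%R].
  apply/seteqP; split => x [Dx]; first by move=> sx; split => //=; rewrite sx subrr.
  by move=> /eqP; rewrite subr_eq0 => /eqP.
have mf : measurable_fun (r @^-1` D) (fun x => s (r x) - x)%R.
  apply: measurable_funB => //; apply: (measurable_comp _ _ ms) => //.
    by move=> _ [x Dx <-]; exact/T01/DT.
  exact: measurable_funS mr.
exact: mf.
Qed.

(** For i = (q, m, l): the derivative is known up to e, the expansion bound holds within radius
    1/(m+1), and the cell has that same length, so the bound applies to every pair of points of the
    piece. *)
Let piece (e : R) (i : nat * nat * nat) : set R :=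
  T `&` [set t | i.1.1%:R * e <= ds t < i.1.1.+1%:R * e]%R
    `&` expanding_set s (i.1.1%:R * e - e) i.1.2
    `&` `[(i.2%:R / i.1.2.+1%:R)%R, (i.2.+1%:R / i.1.2.+1%:R)%R[%classic.

Let mpiece e i : measurable (piece e i).
Proof.
apply: measurableI => //; apply: measurableI; last exact: measurable_expanding_set.
have := mds mT (measurable_itv `[(i.1.1%:R * e)%R, (i.1.1.+1%:R * e)%R[).
by congr measurable; apply/seteqP; split => t [Tt]/=; rewrite in_itv.
Qed.

Let piece_cover (e : R) : (0 < e)%R -> T `<=` \bigcup_i piece e i.
Proof.
move=> e0 t Tt.
have t01 : t \in `]0%R, 1%R[ by exact: T01.
have [k k0 kP] := is_derive1_near (sds Tt) e0.
have [m _ /(_ m (leqnn _))/= mk] := near_infty_natSinv_lt (PosNum k0).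
(* The index m makes 1/(m+1) smaller than the radius granted by the derivative; q and l number the
   cells that contain [ds t] and t. *)
pose q := Num.truncn (ds t / e); pose l := Num.truncn (t * m.+1%:R).
have q0 : (0 <= ds t / e)%R by rewrite divr_ge0 ?ds0// ltW.
have /andP[q1 q2] := truncn_itv q0.
have l0 : (0 <= t * m.+1%:R)%R by move: t01; rewrite in_itv/= => /andP[/ltW ? _]; exact: mulr_ge0.
have /andP[l1 l2] := truncn_itv l0.
exists (q, m, l) => //; split => /=; last first.
  by rewrite in_itv/= ler_pdivrMr// ltr_pdivlMr// l1.
split; first by split => //=; rewrite -ler_pdivlMr// -ltr_pdivrMr// q1.
split => // t' t'01 tt'; apply: le_trans (kP _ (lt_trans tt' mk)).
rewrite ler_wpM2r ?sqr_ge0// lerB// -ler_pdivlMr//.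
Qed.

(** On the piece, [ds] is at most (q + 1) e while [s] stretches by at least (q - 1) e; the gap is 2
    e. When (q - 1) e <= 0 its term is bounded trivially. *)
Let le_piece (e : R) i D : (0 < e)%R -> measurable D -> D `<=` piece e i ->
  \int[mu]_(t in D) (ds t)%:E <= mu (Y D) + (2 * e)%:E * mu D.
Proof.
move=> e0 mD Dp.
have DT : D `<=` T by move=> t /Dp[[[]]].
set q := (i.1.1%:R : R).
apply: (@le_trans _ _ (((q + 1) * e)%:E * mu D)).
  rewrite -integral_cst//; apply: ge0_le_integral => //.
  - by move=> t /DT Tt; rewrite lee_fin ds0.
  - by apply/measurable_EFinP; exact: measurable_funS mds.
  - move=> t /Dp[[[_ /= /andP[_ /ltW dsq] _ _]]].
    by rewrite lee_fin (le_trans dsq)// -natr1.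
have -> : ((q + 1) * e)%:E * mu D = (q * e - e)%:E * mu D + (2 * e)%:E * mu D.
  have fD : mu D \is a fin_num.
    rewrite ge0_fin_numE//; apply: (@le_lt_trans _ _ (mu I01)).
      by apply: le_measure; rewrite ?inE//; exact: subset_trans T01.
    by rewrite lebesgue_measure_itv/= lte_fin ltr01 -EFinD ltry.
  by rewrite -(fineK fD) -!EFinM -EFinD; congr (_%:E); ring.
rewrite leeD2r//; have [a0|a0] := leP (q * e - e)%R 0%R.
  by apply: (@le_trans _ _ 0) => //; rewrite mule_le0_ge0// lee_fin.
apply: (@lebesgue_measure_expanding _ _ s) => //.
- exact: measurable_funS (subset_trans DT T01) ms.
- by move=> t Dt; rewrite /Y/= (rs (DT _ Dt)).
move=> t t' Dt Dt'; rewrite le_eqVlt => /predU1P[->|tt'].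
  by rewrite !subrr mulr0.
have t't0 : (0 < t' - t)%R by rewrite subr_gt0.
have [[_ [_ tP]] tl] := Dp _ Dt; have [_ tl'] := Dp _ Dt'.
rewrite -(ler_pM2r t't0) -mulrA -expr2; apply: tP; first exact/T01/DT.
move: tl tl'; rewrite /= !in_itv/= => /andP[tl _] /andP[_ tl'].
rewrite gtr0_norm// ltrBlDr (lt_le_trans tl')// -natr1 mulrDl mul1r addrC.
by rewrite lerD2l.
Qed.

(** The pieces are made disjoint, and [r] keeps their images disjoint. With e / 2 as the step, the
    errors add up to at most e, because [T] lies in ]0, 1[. *)
Lemma le_integral_derivative_image : \int[mu]_(t in T) (ds t)%:E <= mu S.
Proof.
pose f (e : R) k := if unpickle k is Some i then piece e i else set0.
pose g e := seqDU (f e).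
have mf e k : measurable (f e k) by rewrite /f; case: unpickle => // i; exact: mpiece.
have mg e k : measurable (g e k).
  by apply: measurableD => //; apply: bigsetU_measurable => i _.
have tg e : trivIset setT (g e) by exact: trivIset_seqDU.
have gf e k : g e k `<=` f e k by move=> t [].
have fT e k : f e k `<=` T by rewrite /f; case: unpickle => // i t [[[]]].
have gT e k : g e k `<=` T by exact: subset_trans (fT e k).
have gU e : (0 < e)%R -> \bigcup_k g e k = T.
  move=> e0; apply/seteqP; split => [t [k _ /gT//]|t Tt].
  rewrite -seqDU_bigcup_eq; have [i _ pt] := piece_cover e0 Tt.
  by exists (pickle i) => //; rewrite /f pickleK.
apply/lee_addgt0Pr => e e0; have e20 : (0 < e / 2)%R by rewrite divr_gt0.
rewrite -{1}(gU _ e20) ge0_integral_bigcup//; last 2 first.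
- by rewrite gU//; exact/measurable_EFinP.
- by move=> t; rewrite gU// => Tt; rewrite lee_fin ds0.
apply: (@le_trans _ _ (\sum_(0 <= k <oo) (mu (Y (g (e / 2)%R k)) + e%:E * mu (g (e / 2)%R k)))).
  apply: lee_nneseries => [k _ _|k _].
    by apply: integral_ge0 => t /gT Tt; rewrite lee_fin ds0.
  have := mg (e / 2)%R k; have := @gf (e / 2)%R k; rewrite {1}/f; case: unpickle => [i|] gp mgk.
    rewrite -[X in X%:E * _](_ : 2 * (e / 2) = e)%R; last by field.
    exact: (le_piece e20 mgk gp).
  have -> : g (e / 2)%R k = set0 by apply/seteqP; split.
  by rewrite integral_set0 measure0 mule0 adde0.
rewrite nneseriesD//; last by move=> k _ _; rewrite mule_ge0// lee_fin ltW.
have tY : trivIset setT (fun k => Y (g (e / 2)%R k)).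
  apply/trivIsetP => i j _ _ ij; apply/seteqP; split => // x [[gi _] [gj _]].
  by have /trivIsetP/(_ i j I I ij)/seteqP[+ _] := tg (e / 2)%R => /(_ (r x)); apply.
apply: leeD.
  rewrite -measure_semi_bigcup//; last 2 first.
  - by move=> k; exact: mY.
  - by apply: bigcupT_measurable => k; exact: mY.
  apply: le_measure; rewrite ?inE//; first by apply: bigcupT_measurable => k; exact: mY.
  by move=> x [k _ [/gT gx sx]]; have := TS gx; rewrite sx.
rewrite nneseriesZl// -measure_semi_bigcup//; last by rewrite gU.
  rewrite gU// -[leRHS]mule1 lee_pmul2l ?lte_fin//.
  apply: (@le_trans _ _ (mu I01)); first by apply: le_measure; rewrite ?inE.
  by rewrite lebesgue_measure_itv/= lte_fin ltr01 -EFinD subr0.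
exact: mg.
exact: mg.
Qed.

End area.

End one_dimensional_area_formula.

(** * From an inequality on sets to one on nonnegative functions *)

Section ge0_integral_transfer.
Context d d' (X : measurableType d) (Y : measurableType d') (R : realType).
Variables (mu : {measure set X -> \bar R}) (nu : {measure set Y -> \bar R}).
Variables (phi : X -> Y) (w : X -> R).
Hypothesis mphi : measurable_fun setT phi.
Hypothesis mw : measurable_fun setT w.

Let mwE : measurable_fun setT (EFin \o w). Proof. exact/measurable_EFinP. Qed.

Local Open Scope ereal_scope.
Hypothesis w0 : forall x, (0 <= w x)%R.
Hypothesis le_set : forall B, measurable B ->
  \int[mu]_x ((w x)%:E * (\1_B (phi x))%:E) <= nu B.

Import HBNNSimple.

Let le_nnsfun (g : {nnsfun Y >-> R}) :
  \int[mu]_x ((w x)%:E * (g (phi x))%:E) <= \int[nu]_y (g y)%:E.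
Proof.
have mi r : measurable_fun setT (fun x => (\1_(g @^-1` [set r]) (phi x))%:E : \bar R).
  by apply/measurable_EFinP; apply: measurableT_comp => //; exact: measurable_indic.
rewrite (eq_integral (fun x => \sum_(r \in range g)
    (r%:E * ((w x)%:E * (\1_(g @^-1` [set r]) (phi x))%:E)))); last first.
  move=> x _; rewrite (fimfunE g (phi x)) -fsumEFin// ge0_mule_fsumr//; last first.
    by move=> r; exact: nnfun_muleindic_ge0.
  by apply: eq_fsbigr => r _; rewrite EFinM muleCA.
rewrite ge0_integral_fsum//; first last.
- move=> r x _; have [r0|r0] := leP 0%R r; first by rewrite !mule_ge0 ?lee_fin.
  by rewrite preimage_nnfun0// indicE in_set0 !mule0.
- move=> r; apply: measurable_funeM; exact: emeasurable_funM.
rewrite (eq_integral (fun y => \sum_(r \in range g) (r%:E * (\1_(g @^-1` [set r]) y)%:E))); last first.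
  by move=> y _; rewrite (fimfunE g y) -fsumEFin//.
rewrite ge0_integral_fsum//; first last.
- by move=> r y _; exact: nnfun_muleindic_ge0.
- move=> r; apply: measurable_funeM; exact/measurable_EFinP/measurable_indic.
rewrite !fsbig_finite//=; apply: lee_sum => r _.
have [r0|r0] := leP 0%R r; last first.
  by rewrite preimage_nnfun0//; under eq_integral do rewrite indicE in_set0 !mule0;
    rewrite integral0; apply: integral_ge0 => y _; rewrite indicE in_set0 mule0.
rewrite !ge0_integralZl//; first last.
- by move=> x _; rewrite mule_ge0 ?lee_fin.
- exact: emeasurable_funM.
- exact/measurable_EFinP/measurable_indic.
rewrite lee_wpmul2l// integral_indic// setIT; exact: le_set.
Qed.

(** The hypothesis says that the image by [phi] of the measure of density [w] is below [nu];
    linearity extends this to simple functions and monotone convergence to [f]. *)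
Lemma ge0_le_integral_transfer (f : Y -> \bar R) : measurable_fun setT f ->
  (forall y, 0 <= f y) ->
  \int[mu]_x ((w x)%:E * f (phi x)) <= \int[nu]_y f y.
Proof.
move=> mf f0; pose g := nnsfun_approx measurableT mf.
have gf y : (g k y)%:E @[k --> \oo] --> f y by exact: cvg_nnsfun_approx.
have gnd y : nondecreasing_seq (fun k => (g k y)%:E).
  by move=> a b ab; rewrite lee_fin; exact/lefP/nd_nnsfun_approx.
have mg k : measurable_fun setT (fun x => (w x)%:E * (g k (phi x))%:E).
  apply: emeasurable_funM => //; apply/measurable_EFinP.
  exact: measurableT_comp.
have ndw x : nondecreasing_seq (fun k => (w x)%:E * (g k (phi x))%:E).
  by move=> a b ab; rewrite lee_wpmul2l ?lee_fin//; exact: (gnd _ _ _ ab).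
have cvgw x : ((w x)%:E * (g k (phi x))%:E) @[k --> \oo] --> (w x)%:E * f (phi x).
  exact: cvgeZl.
rewrite (eq_integral (fun x => limn (fun k => (w x)%:E * (g k (phi x))%:E))); last first.
  by move=> x _; apply/esym/cvg_lim.
rewrite monotone_convergence//; last first.
  by move=> k x _; rewrite mule_ge0// lee_fin.
apply: lime_le.
  apply: ereal_nondecreasing_is_cvgn => a b ab; apply: ge0_le_integral => //.
  - by move=> x _; rewrite mule_ge0// lee_fin.
  - by move=> x _; exact: ndw.
apply: nearW => k; apply: (le_trans (le_nnsfun (g k))); apply: ge0_le_integral => //.
- by move=> y _; rewrite lee_fin.
- by apply/measurable_EFinP.
- move=> y _; rewrite -(cvg_lim _ (gf y))//.
  apply: lime_ge; first exact: ereal_nondecreasing_is_cvgn.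
  by exists k => // m /= km; exact: gnd.
Qed.

End ge0_integral_transfer.

(** * Lower integrals over sets that may fail to be measurable *)

Section inner_approximation.
Context d (T : measurableType d) (R : realType).
Variable mu : {measure set T -> \bar R}.
Local Open Scope ereal_scope.

Import HBNNSimple.

(* The library's integral over a non-measurable set is a lower integral. *)
Lemma ge0_integral_inner (D : set T) (f : T -> \bar R) :
  (forall x, D x -> 0 <= f x) ->
  exists E, [/\ measurable E, E `<=` D & \int[mu]_(x in D) f x = \int[mu]_(x in E) f x].
Proof.
move=> f0; rewrite (ge0_integralE _ f0)/=.
set Z := (X in ereal_sup X).
have Zne : Z != set0.
  apply/set0P; exists (sintegral mu (@nnsfun0 _ T R)), nnsfun0 => // x.
  by rewrite /patch; case: ifPn => //; rewrite inE => /f0.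
have [u Zu ucvg] := ereal_sup_seq Zne.
have h_ k : exists2 h : {nnsfun T >-> R}, (forall x, (h x)%:E <= (f \_ D) x) &
    sintegral mu h = u k.
  by have [h] := Zu k; exists h.
have [h hP] := choice (fun k => let: ex_intro2 h p q := h_ k in ex_intro _ h (conj p q)).
(* The simple functions [h k] lie below [f] on [D] and have integrals tending to the supremum;
   outside [D] they vanish, so their supports already carry the whole integral. *)
pose E := \bigcup_k (h k @^-1` ~` [set 0%R]).
have mE : measurable E.
  apply: bigcupT_measurable => k; rewrite -[X in measurable X]setTI.
  by apply: measurable_funP => //; exact: measurableC.
have ED : E `<=` D.
  move=> x [k _ /=]; apply: contra_notP => Dx; have := (hP k).1 x.
  by rewrite patchN ?notin_setE// lee_fin => hx; apply/eqP; rewrite eq_le hx fun_ge0.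
exists E; split => //; rewrite (ge0_integralE _ (fun x Ex => f0 x (ED x Ex))).
apply/eqP; rewrite eq_le; apply/andP; split; last first.
  apply: le_ereal_sup => _ [g gfE <-]; exists g => // x.
  apply: (le_trans (gfE x)); rewrite /patch; case: ifPn; first by rewrite inE => /ED Dx; rewrite mem_set.
  by move=> _; case: ifPn => //; rewrite inE => /f0.
have <- := cvg_lim _ ucvg => //; apply: lime_le; first by apply/cvg_ex; exists (ereal_sup Z).
apply: nearW => k; rewrite -(hP k).2; apply: ereal_sup_ubound; exists (h k) => // x.
rewrite /patch; case: ifPn => [|]; first by rewrite inE => Ex; have := (hP k).1 x; rewrite patchE mem_set//; exact: ED.
rewrite notin_setE => Ex; rewrite lee_fin leNgt; apply/negP => hx.
by apply: Ex; exists k => //= hx0; move: hx; rewrite hx0 ltxx.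
Qed.

End inner_approximation.

(** * Gradients and chart coordinates *)

Lemma measurable_invr (R : realType) :
  measurable_fun [set: measurableTypeR R] (fun t => (t : R)^-1 : measurableTypeR R).
Proof.
rewrite -(setvU [set (0 : R)]); apply/measurable_funU; [exact: measurableC|by []|split].
- apply: open_continuous_measurable_fun.
    rewrite (_ : ~` _ = [set x | x != 0]); first exact: open_neq.
    by apply/seteqP; split => x /= /eqP.
  by move=> t; rewrite inE/= => /eqP t0; exact: inv_continuous.
- exact: measurable_fun_set1.
Qed.

Section gradient_theory.
Context (R : realType) (n : nat).
Implicit Types (phi : 'rV[R]_n -> R) (y w : 'rV[R]_n).

Lemma lipschitz_continuous_rV phi : lipschitz phi -> continuous phi.
Proof.
move=> /pinfty_ex_gt0[M M0 ML] x A /= /nbhs_ballP[e /= e0 xeA].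
apply/nbhs_ballP; exists (e / M) => /=; first by rewrite divr_gt0.
move=> y; rewrite -ball_normE/= ltr_pdivlMr// mulrC => xy; apply: xeA.
by rewrite -ball_normE/=; apply: le_lt_trans xy; exact: (ML (x, y)).
Qed.

Lemma diff_gradient phi y w : differentiable phi y ->
  'd phi y w = dot (gradient phi y) w.
Proof.
move=> dphi; rewrite {1}(row_sum_delta w) linear_sum; apply: eq_bigr => i _.
by rewrite linearZ/= !mxE deriveE// mulrC.
Qed.

Lemma is_derive_chain phi y w (k : R -> R) (t dk : R) :
  differentiable phi (y + k t *: w) -> is_derive t 1 k dk ->
  is_derive t 1 (fun u => phi (y + k u *: w))
    (dk * dot (gradient phi (y + k t *: w)) w).
Proof.
move=> dphi [kt kE]; have dk' : differentiable k t by apply/derivable1_diffP.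
pose g u := y + k u *: w.
have dg : differentiable g t.
  by apply: differentiableD => //; exact: differentiableZl.
have dpg : differentiable (phi \o g) t by exact: differentiable_comp.
split; first exact/derivable1_diffP.
rewrite deriveE// diff_comp//=.
have -> : 'd g t 1 = dk *: w.
  rewrite -deriveE// derive_mx; last exact/derivable1_diffP.
  apply/matrixP => i j; rewrite !mxE -kE.
  rewrite (_ : (fun _ => _) = cst (y i j) + w i j *: k); last first.
    by apply/funext => u; rewrite /g !mxE/= mulrC.
  by rewrite deriveD ?derive_cst ?add0r ?deriveZ 1?mulrC//; exact: derivableZ.
by rewrite linearZ/= diff_gradient.
Qed.

(** A partial derivative is the limit on [E] of the difference quotients of step 1/(k+1), each
    measurable because [phi] is continuous. *)
Lemma measurable_gradient phi (E : set 'rV[R]_n) i : continuous phi ->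
  measurable E -> (forall y, E y -> differentiable phi y) ->
  measurable_fun E (fun y => gradient phi y 0 i : measurableTypeR R).
Proof.
move=> cphi mE dphi.
pose h (k : nat) y := k.+1%:R * (phi (y + k.+1%:R^-1 *: delta_mx 0 i) - phi y).
apply: (@measurable_fun_cvg _ _ _ E h).
  move=> k; apply: (measurable_funS measurableT) => //.
  have mphi := continuous_measurable_rV cphi.
  apply: measurable_funM => //; apply: measurable_funB => //.
  by apply: (measurableT_comp mphi); apply: measurable_fun_rVD.
move=> y Ey; rewrite mxE.
have := @diff_derivable _ _ _ phi y (delta_mx 0 i) (dphi _ Ey).
rewrite /derivable /derive => /cvg_ex[l cl]; rewrite (cvg_lim _ cl)//.
have k0 : (forall k, (k.+1%:R^-1 : R) != 0) /\ (k.+1%:R^-1 : R) @[k --> \oo] --> (0 : R).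
  by split; [move=> k; rewrite invr_eq0|exact: cvg_harmonic].
rewrite (_ : h^~ y = fun k : nat => (k.+1%:R^-1)^-1 *:
    ((phi \o shift y) (k.+1%:R^-1 *: delta_mx 0 i) - phi y)).
  exact: ((cvgr_dnbhsP _ _ _).1 cl _ k0).
by apply/funext => k; rewrite /h invrK /= [y + _]addrC.
Qed.

End gradient_theory.

Section chart_theory.
Context (R : realType) (n : nat) (c : chart R n).
Hypothesis cQ : chart_frame c *m (chart_frame c)^T = 1%:M.
Implicit Types (s t : R) (y : 'rV[R]_n).

Lemma cons_rVD s t y y' :
  cons_rV (s, y) + cons_rV (t, y') = cons_rV (s + t, y + y') :> 'rV[R]_n.+1.
Proof. by apply: eq_rVS => [|i]; rewrite [LHS]mxE !(cons_rV0, cons_rV_lift)//= mxE. Qed.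

Lemma cons_rVZ t s y : t *: cons_rV (s, y) = cons_rV (t * s, t *: y) :> 'rV[R]_n.+1.
Proof. by apply: eq_rVS => [|i]; rewrite [LHS]mxE !(cons_rV0, cons_rV_lift)//= mxE. Qed.

Lemma chart_pointK s y : chart_point c s y *m (chart_frame c)^T = cons_rV (s, y).
Proof. by rewrite -mulmxA cQ mulmx1. Qed.

Lemma chart_pointE x : exists s y, x = chart_point c s y.
Proof.
have QQ := mulmx1C cQ; have /= := uncons_rVK (x *m (chart_frame c)^T).
case: (uncons_rV _) => s y E; exists s, y.
by rewrite /chart_point E -mulmxA QQ mulmx1.
Qed.

Lemma chart_point_homothety s0 y0 s y t :
  chart_point c s0 y0 + t *: (chart_point c s y - chart_point c s0 y0) =
  chart_point c (s0 + t * (s - s0)) (y0 + t *: (y - y0)).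
Proof.
rewrite /chart_point -mulmxBl scalemxAl -mulmxDl; congr (_ *m _).
by rewrite -scaleN1r !(cons_rVZ, cons_rVD) mulN1r scaleN1r.
Qed.

Lemma dot_chart_point s y s' y' :
  dot (chart_point c s y) (chart_point c s' y') = s * s' + dot y y'.
Proof.
rewrite dot_orthogonal// /dot big_ord_recl !cons_rV0; congr (_ + _).
by apply: eq_bigr => i _; rewrite !cons_rV_lift.
Qed.

End chart_theory.

Lemma measurable_fun_indic d d' (T : measurableType d) (T' : measurableType d')
    (R : realType) (B : set T') (f : T -> T') :
  measurable B -> measurable_fun setT f ->
  measurable_fun setT (fun t => \1_B (f t) : R).
Proof.
move=> mB mf; have mi : measurable_fun setT (\1_B : T' -> R) by exact: measurable_indic.
exact: measurableT_comp mi mf.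
Qed.

(** * The cone over a part of a single graph *)

Section cone_inequality.
Context (R : realType) (n : nat) (c : chart R n).
Hypothesis cQ : chart_frame c *m (chart_frame c)^T = 1%:M.
Hypothesis cL : lipschitz (chart_fun c).
Variables (s0 : R) (y0 : 'rV[R]_n).
Local Notation phi := (chart_fun c).

(* The surface Jacobian (x - x0) . n times the area factor, at the graph point
   above y, for the centre x0 of local coordinates (s0, y0). *)
Definition flux_density (y : 'rV[R]_n) : R :=
  phi y - s0 - dot (gradient phi y) (y - y0).

Let x0 := chart_point c s0 y0.

Definition cone_point (z : measurableTypeR R * 'rV[R]_n) : 'rV[R]_n.+1 :=
  x0 + (z.1 : R) *: (graph_point c z.2 - x0).

Let cone_pointE t y : cone_point (t, y) =
  chart_point c (s0 + t * (phi y - s0)) (y0 + t *: (y - y0)).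
Proof. exact: chart_point_homothety. Qed.

Variable E : set 'rV[R]_n.
Hypothesis mE : measurable E.
Hypothesis dE : forall y, E y -> differentiable phi y.
Hypothesis E0 : forall y, E y -> 0 <= flux_density y.

Let cphi : continuous phi. Proof. exact: lipschitz_continuous_rV. Qed.

Let mphi : measurable_fun [set: 'rV[R]_n] (phi : _ -> measurableTypeR R).
Proof. exact: continuous_measurable_rV. Qed.

Lemma measurable_flux_density :
  measurable_fun E (flux_density : _ -> measurableTypeR R).
Proof.
apply: measurable_funB.
  by apply: (measurable_funS measurableT) => //; exact: measurable_funB.
apply: measurable_sum => i; apply: measurable_funM; first exact: measurable_gradient.
apply: (measurable_funS measurableT) => //.
by apply: measurable_fun_coor; apply: measurable_fun_rVD => //; exact: measurable_cst.
Qed.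

Lemma measurable_area_factor :
  measurable_fun E (area_factor phi : _ -> measurableTypeR R).
Proof.
apply: (@measurableT_comp _ _ _ _ _ _ (Num.sqrt : R -> R)).
  exact: continuous_measurable_fun (@sqrt_continuous R).
apply: measurable_funD => //; apply: measurable_sum => i.
by apply: measurable_funM; exact: measurable_gradient.
Qed.

Let H y : R := flux_density y * \1_E y.

Let mH : measurable_fun [set: 'rV[R]_n] (H : _ -> measurableTypeR R).
Proof.
rewrite (_ : H = flux_density \_ E).
  by apply/(measurable_restrictT _ mE); exact: measurable_flux_density.
apply/funext => y; rewrite /H indicE patchE.
by case: (boolP (y \in E)); rewrite (mulr1, mulr0).
Qed.

Let H0 y : 0 <= H y.
Proof.
rewrite /H indicE; case: (boolP (y \in E)) => [|_]; last by rewrite mulr0.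
by rewrite inE mulr1 => /E0.
Qed.

Let i01 (t : measurableTypeR R) : R := \1_(`]0%R, 1%R[%classic : set R) t.

Let mi01 : measurable_fun [set: measurableTypeR R] (i01 : _ -> measurableTypeR R).
Proof. exact: measurable_indic. Qed.

Let w (z : measurableTypeR R * 'rV[R]_n) : R := i01 z.1 * z.1 ^+ n * H z.2.

Let mw : measurable_fun [set: measurableTypeR R * 'rV[R]_n] (w : _ -> measurableTypeR R).
Proof.
apply: measurable_funM; last exact: measurableT_comp.
apply: measurable_funM; first exact: measurableT_comp.
by apply: measurable_funX; exact: measurable_fst.
Qed.

Let w0 z : 0 <= w z.
Proof.
rewrite /w mulr_ge0// /i01 indicE; case: (boolP (_ \in _)) => [|_]; last by rewrite mul0r.
by rewrite inE/= in_itv/= => /andP[z0 _]; rewrite mul1r exprn_ge0// ltW.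
Qed.

Let mcone : measurable_fun [set: measurableTypeR R * 'rV[R]_n] cone_point.
Proof.
rewrite (_ : cone_point = fun z => chart_point c (s0 + (z.1 : R) * (phi z.2 - s0))
    (y0 + (z.1 : R) *: (z.2 - y0))); last by apply/funext => -[t y]; exact: cone_pointE.
apply: measurable_fun_rVM; apply: measurable_fun_cons_rV.
  apply: measurable_funD => //; apply: measurable_funM; first exact: measurable_fst.
  by apply: measurable_funB => //; exact: measurableT_comp.
apply: measurable_fun_rVD; first exact: measurable_cst.
apply: measurable_fun_rVZ; first exact: measurable_fst.
by apply: measurable_fun_rVD; [exact: measurable_snd|exact: measurable_cst].
Qed.

(** On the cone, [rho] recovers the ratio t; it is the left inverse required by the one-dimensional
    inequality on every vertical line. [C] is a measurable set containing the cone. *)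
Variables (rho : 'rV[R]_n.+1 -> R) (C : set 'rV[R]_n.+1).
Hypothesis mrho : measurable_fun [set: 'rV[R]_n.+1] (rho : _ -> measurableTypeR R).
Hypothesis mC : measurable C.
Hypothesis rhoE : forall t y, 0 < t < 1 -> E y -> rho (cone_point (t, y)) = t.
Hypothesis coneC : forall t y, 0 < t < 1 -> E y -> C (cone_point (t, y)).

Section vertical_line.
Variable y' : 'rV[R]_n.

(** The base point whose cone point of ratio t lies above y'. Fixing y' and letting t vary thus
    moves the cone point along a vertical line, at height [line t]. *)
Let g (t : R) : 'rV[R]_n := y0 + t^-1 *: (y' - y0).

Let line (t : R) : R := s0 + t * (phi (g t) - s0).

Let line_cone t : t != 0 -> cone_point (t, g t) = chart_point c (line t) y'.
Proof.
move=> t0; rewrite cone_pointE /g; congr chart_point.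
by rewrite [_ - y0]addrAC subrr add0r scalerA divff// scale1r addrC subrK.
Qed.

(** The derivative of t (phi(g t) - s0) is phi(g t) - s0 - grad phi . (y' - y0) / t, and (y' - y0) /
    t is g t - y0. *)
Let is_derive_line t : t != 0 -> differentiable phi (g t) ->
  is_derive t 1 line (flux_density (g t)).
Proof.
move=> t0 dphi.
have dV : is_derive t 1 (fun u : R => u^-1) (- t ^- 2).
  by apply: is_derive_eq; [exact: is_deriveV|rewrite /GRing.scale/= mulr1].
have dpg := is_derive_chain dphi dV.
have -> : line = cst s0 + id * ((fun u => phi (y0 + u^-1 *: (y' - y0))) - cst s0) by [].
apply: is_derive_eq.
rewrite /flux_density (_ : g t - y0 = t^-1 *: (y' - y0)); last first.
  by rewrite /g addrAC subrr add0r.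
rewrite dotZr -/(g t); set D := dot _ _.
transitivity (0 + (t * (- t ^- 2 * D - 0) + (phi (g t) - s0) * 1)); first by [].
by field.
Qed.

Let continuous_line : {in `]0%R, 1%R[, continuous line}.
Proof.
move=> t; rewrite in_itv/= => /andP[t0 _].
apply: cvgD; first exact: cvg_cst.
apply: cvgM; first exact: cvg_id.
apply: cvgB; last exact: cvg_cst.
apply: (@continuous_comp _ _ _ g phi); last exact: cphi.
apply: cvgD; first exact: cvg_cst.
apply: cvgZr_tmp; apply: inv_continuous; exact: lt0r_neq0.
Qed.

Let mg : measurable_fun [set: measurableTypeR R] (g : measurableTypeR R -> 'rV[R]_n).
Proof.
apply: measurable_fun_rVD; first exact: measurable_cst.
by apply: measurable_fun_rVZ; [exact: measurable_invr|exact: measurable_cst].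
Qed.

Let mchart : measurable_fun [set: measurableTypeR R]
  (fun s : measurableTypeR R => chart_point c s y').
Proof.
by apply: measurable_fun_rVM; apply: measurable_fun_cons_rV => //; exact: measurable_cst.
Qed.

(** The one-dimensional inequality for the height [line], on the set of ratios where the integrand
    does not vanish by an indicator. *)
Lemma cone_line_inequality (B : set 'rV[R]_n.+1) : measurable B ->
  (\int[lebesgue_measure]_t (i01 t * H (g t) * \1_B (cone_point (t, g t)))%:E <=
   lebesgue_measure [set s : R | (B `&` C) (chart_point c s y')])%E.
Proof.
move=> mB.
have mBcone : measurable [set t : measurableTypeR R | B (cone_point (t, g t))].
  rewrite -[X in measurable X]setTI.
  have /(_ measurableT _ mB) := measurableT_comp mcone (measurable_fun_pair (@measurable_id _ _ _) mg).
  exact.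
pose T : set R := `]0%R, 1%R[%classic `&` [set t | E (g t)] `&`
  [set t | B (cone_point (t, g t))].
have mT : measurable T.
  apply: measurableI => //; apply: measurableI => //.
  by rewrite -[X in measurable X]setTI; exact: mg.
have T01 : T `<=` `]0%R, 1%R[%classic by move=> t [[]].
have T0 t : T t -> t != 0 by move=> [[/= + _] _]; rewrite in_itv/= => /andP[/lt0r_neq0].
have TE t : T t -> E (g t) by move=> [[]].
have -> : (\int[lebesgue_measure]_t (i01 t * H (g t) * \1_B (cone_point (t, g t)))%:E =
    \int[lebesgue_measure]_(t in T) (flux_density (g t))%:E)%E.
  rewrite [RHS]integral_mkcond; apply: eq_integral => t _; rewrite patchE.
  case: ifPn => [|]; [rewrite inE => -[[t01 Et] Bt]|rewrite notin_setE => Tt].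
    by rewrite /i01 /H !indicE !mem_set// mul1r !mulr1.
  rewrite /i01 /H !indicE; case: (boolP (t \in _)); last by rewrite mul0r mul0r.
  case: (boolP (g t \in E)); last by rewrite mulr0 mulr0 mul0r.
  case: (boolP (_ \in B)); last by rewrite mulr0.
  by rewrite !inE => Bt Et t01; exfalso; exact: Tt.
have lineE t : T t -> cone_point (t, g t) = chart_point c (line t) y'.
  by move=> /T0; exact: line_cone.
have t01 t : T t -> 0 < t < 1 by move=> [[/= + _] _]; rewrite in_itv.
apply: (@le_integral_derivative_image _ T _ line (fun s => rho (chart_point c s y'))) => //.
- rewrite -[X in measurable X]setTI.
  by apply: mchart => //; exact: measurableI.
- exact: measurableT_comp mrho mchart.
- apply: (measurable_comp mE _ measurable_flux_density).
    by move=> _ [t Tt <-]; exact: TE.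
  exact: measurable_funS mg.
- by move=> t /TE; exact: E0.
- move=> t Tt; apply: is_derive_line; [exact: T0|exact/dE/TE].
- by move=> t Tt; rewrite -lineE// rhoE//; [exact: t01|exact: TE].
- move=> t Tt /=; rewrite -lineE//; split; first by case: Tt.
  by apply: coneC; [exact: t01|exact: TE].
Qed.

End vertical_line.

Lemma measurable_column (A : set 'rV[R]_n.+1) : measurable A ->
  measurable_fun [set: 'rV[R]_n]
    (fun y => lebesgue_measure [set s : R | A (cons_rV (s, y))]).
Proof.
move=> mA.
have mcA : measurable (@cons_rV R n @^-1` A).
  rewrite -[X in measurable X]setTI; exact: (measurable_funP (@cons_rV R n)).
have := measurable_fun_ysection (@lebesgue_measure R) mcA.
congr measurable_fun; apply/funext => y /=; congr (lebesgue_measure _).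
by apply/seteqP; split => s; rewrite /ysection /= inE.
Qed.

(** Tonelli with the height integrated first, the opposite of the order in the definition of the
    measure. *)
Lemma lebesgue_rV_column (A : set 'rV[R]_n.+1) : measurable A ->
  (lebesgue_rV R n.+1 A =
   \int[lebesgue_rV R n]_y lebesgue_measure [set s : R | A (cons_rV (s, y))])%E.
Proof.
move=> mA.
have mcA : measurable (@cons_rV R n @^-1` A).
  rewrite -[X in measurable X]setTI; exact: (measurable_funP (@cons_rV R n)).
rewrite -[LHS]/((lebesgue_measure \x lebesgue_rV R n)%E (@cons_rV R n @^-1` A)).
rewrite -(setIT (_ @^-1` _)) -integral_indic// fubini_tonelli2//; last first.
  exact/measurable_EFinP/measurable_indic.
apply: eq_integral => y _.
have mAy : measurable [set s : measurableTypeR R | A (cons_rV (s, y))].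
  rewrite -[X in measurable X]setTI; have : measurable_fun setT (fun s : measurableTypeR R => cons_rV (s, y)).
    by apply: measurable_fun_cons_rV => //; exact: measurable_cst.
  exact.
transitivity (\int[lebesgue_measure]_s (\1_[set s : measurableTypeR R | A (cons_rV (s, y))] s)%:E)%E.
  by apply: eq_integral => s _.
by rewrite integral_indic//; congr (lebesgue_measure _); exact: setIT.
Qed.

Let F (B : set 'rV[R]_n.+1) (z : measurableTypeR R * 'rV[R]_n) : R :=
  let y := y0 + (z.1 : R)^-1 *: (z.2 - y0) in
  i01 z.1 * H y * \1_B (cone_point (z.1, y)).

Let F0 B z : 0 <= F B z.
Proof. by rewrite /F/= mulr_ge0 ?indicE// mulr_ge0// /i01 indicE. Qed.

Let mF B : measurable B -> measurable_fun setT (F B : _ -> measurableTypeR R).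
Proof.
move=> mB.
have mgg : measurable_fun [set: measurableTypeR R * 'rV[R]_n]
    (fun z => y0 + (z.1 : R)^-1 *: (z.2 - y0)).
  apply: measurable_fun_rVD; first exact: measurable_cst.
  apply: measurable_fun_rVZ.
    by apply: (measurableT_comp (@measurable_invr R)); exact: measurable_fst.
  by apply: measurable_fun_rVD; [exact: measurable_snd|exact: measurable_cst].
apply: measurable_funM; last first.
  apply: measurable_fun_indic => //; apply: (measurableT_comp mcone).
  by apply: measurable_fun_pair => //; exact: measurable_fst.
apply: measurable_funM; first by apply: (measurableT_comp mi01); exact: measurable_fst.
exact: (measurableT_comp mH).
Qed.

Let mB_cone B : measurable B -> measurable_fun setT
  (fun z => w z * \1_B (cone_point z) : measurableTypeR R).
Proof.
move=> mB; apply: measurable_funM => //.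
exact: measurable_fun_indic.
Qed.

(** For fixed t, the substitution y' = y0 + t (y - y0) absorbs t^n and turns the integrand into [F].
    After exchanging the integrals, the inequality on each vertical line applies, and orthogonality
    of the frame brings the columns back to [B] and [C]. *)
Let cone_set_inequality B : measurable B ->
  (\int[lebesgue_measure \x lebesgue_rV R n]_z ((w z)%:E * (\1_B (cone_point z))%:E) <=
   lebesgue_rV R n.+1 (B `&` C))%E.
Proof.
move=> mB; under eq_integral do rewrite -EFinM.
have mBC : measurable (B `&` C) by exact: measurableI.
rewrite fubini_tonelli1//; last 2 first.
- by apply/measurable_EFinP; exact: mB_cone mB.
- by move=> z; rewrite lee_fin mulr_ge0.
apply: (@le_trans _ _ (\int[lebesgue_measure]_t \int[lebesgue_rV R n]_y (F B (t, y))%:E)%E).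
  rewrite le_eqVlt; apply/orP; left; apply/eqP; apply: eq_integral => t _; rewrite /fubini_F.
  have [t01|t01] := boolP (t \in (`]0%R, 1%R[%classic : set R)); last first.
    transitivity (0 : \bar R); [|apply/esym]; apply: integral0_eq => y _.
      by rewrite /w /i01/= indicE (negbTE t01) !mul0r.
    by rewrite /F /i01/= indicE (negbTE t01) !mul0r.
  have /andP[t0 _] : 0 < t < 1 by move: t01; rewrite inE/= in_itv.
  have tn0 : t != 0 by rewrite gt_eqF.
  have mFt : measurable_fun setT (fun y => (F B (t, y))%:E).
    apply/measurable_EFinP; apply: (measurableT_comp (mF mB)).
    by apply: measurable_fun_pair; [exact: measurable_cst|exact: measurable_id].
  rewrite -(ge0_integral_rV_affine (y0 - t *: y0) tn0 mFt)//; last first.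
    by move=> y; rewrite lee_fin.
  have mFc : measurable_fun setT (fun y : 'rV[R]_n => (F B (t, (y0 - t *: y0 + t *: y)%R))%:E).
    by apply: (measurableT_comp mFt); exact: measurable_affine_rV.
  rewrite -ge0_integralZl_EFin//; last first.
    by move=> y _; rewrite lee_fin.
  apply: eq_integral => y _; rewrite /F/= -EFinM; congr (_%:E).
  have -> : y0 + t^-1 *: (y0 - t *: y0 + t *: y - y0) = y.
    rewrite addrAC [_ - _ - y0]addrAC subrr add0r -scalerN -scalerDr scalerA mulVf//.
    by rewrite scale1r addrA subrr add0r.
  by rewrite /w /= gtr0_norm//; ring.
rewrite (fubini_tonelli (fun z => (F B z)%:E))//; last 2 first.
- by apply/measurable_EFinP; exact: mF mB.
- by move=> z; rewrite lee_fin.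
rewrite -(lebesgue_rV_orthogonal cQ mBC) lebesgue_rV_column; last first.
  by rewrite -[X in measurable X]setTI; exact: (@measurable_mulmx R _ _ (chart_frame c)).
apply: ge0_le_integral => //.
- by move=> y _; apply: integral_ge0 => t _; rewrite lee_fin.
- apply: (measurable_fun_fubini_tonelli_G (fun z => (F B z)%:E)).
    by apply/measurable_EFinP; exact: mF mB.
  by move=> z; rewrite lee_fin.
- have mQBC : measurable ((fun x => x *m chart_frame c) @^-1` (B `&` C)).
    by rewrite -[X in measurable X]setTI; exact: (@measurable_mulmx R _ _ (chart_frame c)).
  exact: measurable_column.
- by move=> y _; exact: cone_line_inequality.
Qed.

Lemma cone_inequality (f : 'rV[R]_n.+1 -> \bar R) :
  measurable_fun [set: 'rV[R]_n.+1] f -> (forall x, 0 <= f x)%E ->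
  (\int[lebesgue_rV R n]_(y in E) ((flux_density y)%:E *
     \int[lebesgue_measure]_(t in `]0%R, 1%R[) (f (cone_point (t, y)) * (t ^+ n)%:E)) <=
   \int[lebesgue_rV R n.+1]_(x in C) f x)%E.
Proof.
move=> mf f0; rewrite [leRHS]integral_mkcond.
have mfC : measurable_fun setT (f \_ C).
  by apply/(measurable_restrictT _ mC); exact: measurable_funTS.
have fC0 x : (0 <= (f \_ C) x)%E by rewrite patchE; case: ifP.
have mwf : measurable_fun setT (fun z => ((w z)%:E * f (cone_point z))%E).
  apply: emeasurable_funM; first exact/measurable_EFinP.
  exact: measurableT_comp.
have wf0 z : (0 <= (w z)%:E * f (cone_point z))%E by rewrite mule_ge0 ?lee_fin.
have mwfC : measurable_fun setT (fun z => ((w z)%:E * (f \_ C) (cone_point z))%E).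
  apply: emeasurable_funM; first exact/measurable_EFinP.
  exact: measurableT_comp.
apply: le_trans (ge0_le_integral_transfer (mu := (lebesgue_measure \x lebesgue_rV R n)%E)
  (nu := lebesgue_rV R n.+1) mcone mw w0 _ mfC fC0).
  rewrite fubini_tonelli2//; last by move=> z; rewrite mule_ge0 ?lee_fin.
  rewrite [leLHS]integral_mkcond le_eqVlt; apply/orP; left; apply/eqP.
  apply: eq_integral => y _; rewrite patchE /fubini_G.
  case: (boolP (y \in E)) => [yE|yE]; last first.
    by rewrite integral0_eq// => t _; rewrite /w /H/= indicE (negbTE yE) !mulr0 mul0e.
  have Ey : E y by rewrite inE in yE.
  have mty : measurable_fun [set: measurableTypeR R]
      (fun t : measurableTypeR R => (f (cone_point (t, y)) * ((t : R) ^+ n)%:E)%E).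
    apply: emeasurable_funM.
      apply: (measurableT_comp mf); apply: (measurableT_comp mcone).
      by apply: measurable_fun_pair; [exact: measurable_id|exact: measurable_cst].
    by apply/measurable_EFinP; exact: measurable_funX.
  rewrite -ge0_integralZl_EFin//; first last.
  - exact: E0.
  - exact: measurable_funTS.
  - move=> t; rewrite /= in_itv/= => /andP[/ltW t0 _].
    by rewrite mule_ge0// lee_fin exprn_ge0.
  rewrite [LHS]integral_mkcond; apply: eq_integral => t _; rewrite patchE.
  rewrite /w /H /i01/= !indicE yE mulr1.
  case: (boolP (t \in _)) => t01; last by rewrite !mul0r mul0e.
  rewrite patchE mem_set; last first.
    by apply: coneC => //; move: t01; rewrite inE/= in_itv.
  by rewrite mul1r [(t ^+ n * _)%R]mulrC EFinM [(f _ * _)%E]muleC muleA.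
move=> B mB; apply: (le_trans (cone_set_inequality mB)).
by apply: le_measure; rewrite ?inE//; exact: measurableI.
Qed.

End cone_inequality.

(** * Star-shaped closed sets and their gauge *)

Section star_shaped_closure.
Context (R : realType) (n : nat).
Implicit Types (A G : set 'rV[R]_n) (x : 'rV[R]_n).

Lemma star_shaped_closure A x0 : star_shaped A x0 -> star_shaped (closure A) x0.
Proof.
move=> sA x cAx t t01 B /= /nbhs_ballP[e /= e0 eB].
have [z [Az xz]] := cAx _ (nbhsx_ballx x e e0).
exists (x0 + t *: (z - x0)); split; first exact: sA.
apply: eB; move: xz; rewrite -!ball_normE/=; apply: le_lt_trans.
rewrite opprD addrACA subrr add0r -scalerBr opprB addrA subrK normrZ.
by case/andP: t01 => t0 t1; rewrite gtr0_norm// ler_piMl.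
Qed.

Lemma measurable_closure A : measurable (closure A).
Proof.
have oC : open (~` closure A) by apply: closed_openC; exact: closed_closure.
by rewrite -[closure A]setCK; apply: measurableC; exact: open_measurable_rV.
Qed.

(* For a closed set [G], star-shaped about [x0], this is the gauge of [G]
   truncated at 1, written as an integral to make it measurable. *)
Definition gauge G x0 (x : 'rV[R]_n) : R :=
  fine (lebesgue_measure (`]0%R, 1%R[%classic `&`
    [set u : R | ~ G (x0 + u^-1 *: (x - x0))])).

Lemma measurable_gauge G x0 : measurable G ->
  measurable_fun [set: 'rV[R]_n] (gauge G x0 : _ -> measurableTypeR R).
Proof.
move=> mG.
pose A : set ('rV[R]_n * measurableTypeR R) := [set z |
  (`]0%R, 1%R[%classic : set R) z.2 /\ ~ G (x0 + (z.2 : R)^-1 *: (z.1 - x0))].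
have mf : measurable_fun [set: 'rV[R]_n * measurableTypeR R]
    (fun z => x0 + (z.2 : R)^-1 *: (z.1 - x0)).
  apply: measurable_fun_rVD; first exact: measurable_cst.
  apply: measurable_fun_rVZ.
    by apply: (measurableT_comp (@measurable_invr R)); exact: measurable_snd.
  by apply: measurable_fun_rVD; [exact: measurable_fst|exact: measurable_cst].
have mA : measurable A.
  apply: measurableI.
    by rewrite -[X in measurable X]setTI; apply: measurable_snd.
  rewrite -[X in measurable X]setTI.
  exact: (mf measurableT _ (measurableC mG)).
have := measurable_fun_xsection (@lebesgue_measure R) mA.
move=> /(measurableT_comp (fine_measurable measurableT)).
apply: eq_measurable_fun => x _; rewrite /gauge/=; congr (fine (lebesgue_measure _)).
by apply/seteqP; split => u; rewrite /xsection /= inE.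
Qed.

(** The dilated point is x0 + (t / u) (x - x0). It is in [G] when t <= u by star-shapedness; if it
    were for some u < t, star-shapedness would pull it back to a forbidden point just beyond x. The
    set measured is therefore ]0, t[. *)
Lemma gaugeE G x0 x t e0 : star_shaped G x0 -> G x -> 0 < e0 ->
  (forall e, 0 < e < e0 -> ~ G (x + e *: (x - x0))) -> 0 < t < 1 ->
  gauge G x0 (x0 + t *: (x - x0)) = t.
Proof.
move=> sG Gx e00 GNx /andP[t0 t1]; rewrite /gauge.
rewrite (_ : _ `&` _ = `]0%R, t[%classic).
  by rewrite lebesgue_measure_itv/= lte_fin t0 oppr0 adde0.
have homE u : x0 + u^-1 *: (x0 + t *: (x - x0) - x0) = x0 + (t / u) *: (x - x0).
  by rewrite addrAC subrr add0r scalerA mulrC.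
apply/seteqP; split => u /=; rewrite !in_itv/= homE.
  move=> [/andP[u0 u1] NG]; rewrite u0/= ltNge; apply/negP => tu; apply: NG.
  by apply: sG => //; rewrite divr_gt0//= ler_pdivrMr// mul1r.
move=> /andP[u0 ut]; rewrite u0 (lt_trans ut t1); split => // Gtu.
have tu1 : 0 < t / u - 1 by rewrite subr_gt0 ltr_pdivlMr// mul1r.
(* Small enough for x + e (x - x0) to be forbidden and to lie between x0 and the dilated point. *)
pose e := Num.min (e0 / 2) (t / u - 1).
have e_gt0 : 0 < e by rewrite lt_min tu1 divr_gt0.
have ee0 : e < e0 by rewrite gt_min gtr_pMr// invf_lt1// ltr1n.
have etu : 1 + e <= t / u by rewrite addrC -lerBrDr ge_min lexx orbT.
apply: (GNx e); first by rewrite e_gt0.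
have := sG _ Gtu ((1 + e) / (t / u)).
have tu0 : 0 < t / u by rewrite divr_gt0.
rewrite addrAC subrr add0r scalerA divfK ?gt_eqF// scalerDl scale1r addrA.
rewrite [x0 + (x - x0)]addrC subrK; apply.
by rewrite divr_gt0 ?addr_gt0//= ler_pdivrMr// mul1r.
Qed.

End star_shaped_closure.

Lemma continuous_rV (R : realType) (T : topologicalType) n (f : T -> 'rV[R]_n) :
  (forall i, continuous (fun t => f t 0 i)) -> continuous f.
Proof.
move=> cf x; apply/cvg_ballP => e e0; near=> z; split => // i j; rewrite ord1.
move: j; near: z; apply: filter_forall => j.
by have /cvg_ballP/(_ _ e0) := cf j x.
Unshelve. all: end_near. Qed.

Lemma continuous_coor_mulmx (R : realType) m n (Q : 'M[R]_(m, n)) i :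
  continuous (fun x : 'rV[R]_m => (x *m Q) 0 i).
Proof.
apply: lipschitz_continuous_rV; apply: (@klipschitzW _ _ _ (\sum_j `|Q j i|)).
  exact: (@globally_properfilter _ _ (0, 0)).
move=> [x z] _ /=; rewrite !mxE -sumrB mulr_suml.
apply: (le_trans (ler_norm_sum _ _ _)); apply: ler_sum => j _.
rewrite -mulrBl normrM mulrC ler_wpM2l// [leRHS]/Num.Def.normr/= mx_normrE.
by have := le_bigmax 0 (fun i : 'I_1 * 'I_m => `|(x - z) i.1 i.2|) (0, j); rewrite /= !mxE.
Qed.

Lemma continuous_subr (T : topologicalType) (R : realType) (f g : T -> R) :
  continuous f -> continuous g -> continuous (fun x => f x - g x).
Proof. by move=> cf cg x; apply: cvgB; [exact: cf|exact: cg]. Qed.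

(** * The boundary of a Lipschitz domain in a chart *)

Section boundary_chart.
Context (R : realType) (n : nat) (K : set 'rV[R]_n.+1) (c : chart R n).
Hypothesis Kc : is_chart K c.
Implicit Types (x : 'rV[R]_n.+1) (y : 'rV[R]_n).

Let cQ : chart_frame c *m (chart_frame c)^T = 1%:M. Proof. by case: Kc. Qed.
Let cphi : continuous (chart_fun c).
Proof. by apply: lipschitz_continuous_rV; case: Kc. Qed.

Let height x : R := (uncons_rV (x *m (chart_frame c)^T)).1.
Let base x : 'rV[R]_n := (uncons_rV (x *m (chart_frame c)^T)).2.

Let continuous_height : continuous height.
Proof. exact: continuous_coor_mulmx. Qed.

Let continuous_base : continuous base.
Proof.
apply: continuous_rV => i; rewrite (_ : (fun _ => _) =
    fun x : 'rV[R]_n.+1 => (x *m (chart_frame c)^T) 0 (lift 0 i)).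
  exact: continuous_coor_mulmx.
by apply/funext => x; rewrite mxE.
Qed.

Let height_chart s y : height (chart_point c s y) = s.
Proof. by rewrite /height chart_pointK// cons_rVK. Qed.

Let base_chart s y : base (chart_point c s y) = y.
Proof. by rewrite /base chart_pointK// cons_rVK. Qed.

(** By continuity a whole neighbourhood stays in the chart and above the graph, where the chart
    leaves no point of [K]. *)
Lemma above_chart s y : chart_nbhs c (chart_point c s y) -> chart_fun c y < s ->
  ~ closure K (chart_point c s y).
Proof.
have [_ _ oU KU] := Kc => Ux ys clK.
pose d x : R := height x - chart_fun c (base x).
have cd : continuous d.
  apply: continuous_subr; first exact: continuous_height.
  by move=> x; apply: (@continuous_comp _ _ _ base); [exact: continuous_base|exact: cphi].
have dx : 0 < d (chart_point c s y) by rewrite /d height_chart base_chart subr_gt0.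
have nV : nbhs (chart_point c s y) (chart_nbhs c `&` [set x | 0 < d x]).
  apply: filterI; first exact: open_nbhs_nbhs.
  by move: (cd (chart_point c s y)) => /cvgr_gt; apply.
have [z [Kz [Uz dz]]] := clK _ nV.
have [s' [y' zE]] := chart_pointE cQ z.
move: Kz Uz dz; rewrite zE => Kz Uz; rewrite /d/= height_chart base_chart subr_gt0.
by move=> /ltW; rewrite leNgt => /negP; apply; apply/KU.
Qed.

Lemma boundary_chart s y : open K -> boundary K (chart_point c s y) ->
  chart_nbhs c (chart_point c s y) -> s = chart_fun c y.
Proof.
have [_ _ oU KU] := Kc => oK [clK NiK] Ux.
have [sy|ys|//] := ltgtP s (chart_fun c y); last by have := above_chart Ux ys.
exfalso; apply: NiK; rewrite (interior_id _).1//; exact/KU.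
Qed.

(** In the chart, each line parallel to its axis meets the boundary at most once, on the graph. *)
Lemma chart_boundary_null : open K -> measurable (boundary K `&` chart_nbhs c) /\
  lebesgue_rV R n.+1 (boundary K `&` chart_nbhs c) = 0%E.
Proof.
have [_ _ oU _] := Kc => oK.
have mZ : measurable (boundary K `&` chart_nbhs c).
  apply: measurableI; last exact: open_measurable_rV.
  apply: measurableD; first exact: measurable_closure.
  by apply: open_measurable_rV; exact: open_interior.
split => //; apply: (lebesgue_rV_null_direction (e := chart_point c 1 0)) => // x.
have [s [y ->]] := chart_pointE cQ x.
apply/eqP; rewrite eq_le measure_ge0 andbT.
rewrite -(lebesgue_measure_set1 (chart_fun c y - s)).
apply: le_measure; rewrite ?inE.
- exact: measurable_line.
- exact: measurable_set1.
move=> t /=; have -> : chart_point c s y + t *: chart_point c 1 0 = chart_point c (s + t) y.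
  rewrite /chart_point scalemxAl -mulmxDl cons_rVZ cons_rVD mulr1 scaler0 addr0//.
by move=> [bK /(boundary_chart oK bK) <-]; rewrite addrC addKr.
Qed.

Variables (s0 : R) (y0 : 'rV[R]_n).

(** The point lies at height q(e) - q(0) above the graph for the [q] below, and q'(0) is the flux
    density, which is positive. So the ray enters the region above the graph just after y. *)
Lemma above_boundary_point y : differentiable (chart_fun c) y ->
  chart_nbhs c (graph_point c y) -> 0 < flux_density c s0 y0 y ->
  exists2 e0, 0 < e0 & forall e, 0 < e < e0 ->
    ~ closure K (graph_point c y + e *: (graph_point c y - chart_point c s0 y0)).
Proof.
have [_ _ oU _] := Kc => dphi Ux h0; set x := graph_point c y.
set m := x - _; set phi := chart_fun c.
have mE e : x + e *: m = chart_point c (phi y + e * (phi y - s0)) (y + e *: (y - y0)).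
  have -> : x + e *: m = chart_point c s0 y0 + (1 + e) *: m.
    by rewrite scalerDl scale1r addrA addrC /m subrKC addrC.
  rewrite /m chart_point_homothety; congr chart_point; first by rewrite /phi; ring.
  by rewrite scalerDl scale1r addrA subrKC.
pose q e : R := e * (phi y - s0) - phi (y + e *: (y - y0)).
have dq : is_derive (0 : R) (1 : R) q (flux_density c s0 y0 y).
  have dphi' : differentiable phi (y + id 0 *: (y - y0)) by rewrite scale0r addr0.
  have dpg := is_derive_chain dphi' (is_derive_id (0 : R) (1 : R)).
  rewrite /= scale0r addr0 mul1r in dpg.
  have -> : q = id * cst (phi y - s0) - (fun e => phi (y + e *: (y - y0))) by [].
  by apply: is_derive_eq; rewrite scaler0 add0r /GRing.scale/= mulr1.
(* A tolerance of half the derivative leaves a positive lower slope. *)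
have [k k0 kP] := is_derive1_near dq (divr_gt0 h0 (ltr0n _ 2)).
have nU : \forall e \near (0 : R), chart_nbhs c (x + e *: m).
  have cf : {for (0 : R), continuous (fun e : R => x + e *: m)}.
    apply: cvgD; first exact: cvg_cst.
    by apply: cvgZr_tmp; exact: cvg_id.
  by apply: cf; rewrite scale0r addr0; exact: open_nbhs_nbhs.
have [r /= r0 rU] := (nbhs_ballP _ _).1 nU.
exists (Num.min k r); first by rewrite lt_min k0.
move=> e /andP[e0]; rewrite lt_min => /andP[ek er].
have Ue : chart_nbhs c (x + e *: m).
  by apply: rU; rewrite -ball_normE/= sub0r normrN gtr0_norm.
rewrite mE; apply: above_chart; first by rewrite -mE.
have := kP e; rewrite subr0 gtr0_norm// => /(_ ek).
rewrite expr2 mulrA ler_pM2r// => /(lt_le_trans _).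
have hh : 0 < (flux_density c s0 y0 y - flux_density c s0 y0 y / 2) * e.
  by rewrite mulr_gt0//; lra.
move=> /(_ _ hh); rewrite /q mul0r scale0r addr0 sub0r opprK => qe.
by rewrite -/phi; lra.
Qed.

Lemma flux_density_normal y :
  dot (graph_point c y - chart_point c s0 y0)
    ((area_factor (chart_fun c) y)^-1 *: chart_point c 1 (- gradient (chart_fun c) y)) =
  (area_factor (chart_fun c) y)^-1 * flux_density c s0 y0 y.
Proof.
rewrite dotZr; congr (_ * _).
have -> : graph_point c y - chart_point c s0 y0 =
    chart_point c (chart_fun c y - s0) (y - y0).
  rewrite /graph_point /chart_point -mulmxBl -scaleN1r cons_rVZ cons_rVD.
  by rewrite mulN1r scaleN1r.
by rewrite dot_chart_point// mulr1 dotNr dotC.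
Qed.

Lemma area_factor_gt0 phi y : 0 < @area_factor R n phi y.
Proof. by rewrite sqrtr_gt0 ltr_wpDr ?dot_ge0. Qed.

End boundary_chart.

(** * Polynomials on rays *)

Lemma measurable_poly_space (R : realType) n p (v : 'rV[R]_n -> R) :
  poly_space p v -> measurable_fun [set: 'rV[R]_n] (v : _ -> measurableTypeR R).
Proof.
move=> [q _ ->]; under eq_fun do rewrite mpoly.mevalE.
apply: measurable_sum => a; apply: measurable_funM; first exact: measurable_cst.
apply: measurable_prod => i _; apply: measurable_funX; exact: measurable_coor.
Qed.

(** Monotonicity read off the supremum over simple functions; it serves to compare integrands in y
    whose measurability is not established. *)
Lemma ge0_le_lower_integral d (T : measurableType d) (R : realType)
    (mu : {measure set T -> \bar R}) (D : set T) (f g : T -> \bar R) :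
  (forall x, D x -> 0 <= f x)%E -> (forall x, D x -> f x <= g x)%E ->
  (\int[mu]_(x in D) f x <= \int[mu]_(x in D) g x)%E.
Proof.
move=> f0 fg; have g0 x : D x -> (0 <= g x)%E.
  by move=> Dx; exact: le_trans (f0 _ Dx) (fg _ Dx).
rewrite !ge0_integralE//; apply: le_ereal_sup => _ [h hf <-]; exists h => // x.
apply: (le_trans (hf x)); rewrite /patch; case: ifPn => //.
by rewrite inE => Dx; exact: fg.
Qed.

(** The inverse inequality for the polynomial t -> v(x0 + t (x - x0)). The constants stand inside
    the integral to match the cone inequality for a multiple of v^2. *)
Lemma radial_trace_inequality (R : realType) n m p a (v : 'rV[R]_m -> R)
    (x0 x : 'rV[R]_m) : poly_space p v -> 0 <= a ->
  ((a * v x ^+ 2)%:E <= \int[lebesgue_measure]_(t in `]0%R, 1%R[)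
      ((a * ((p + 1) * (p + n.+1))%:R * v (x0 + t *: (x - x0))%R ^+ 2)%:E *
       (t ^+ n)%:E))%E.
Proof.
move=> pv a0; have [w sw wE] := poly_space_line x0 (x - x0) pv.
have -> : v x = w.[1] by rewrite -wE scale1r subrKC.
have mw : measurable_fun setT (fun t : measurableTypeR R => (w * w).[t] * t ^+ n).
  apply: measurable_funM; last exact: measurable_funX.
  by apply: continuous_measurable_fun => t; exact: continuous_horner.
set C := _%:R.
have -> : (\int[lebesgue_measure]_(t in `]0%R, 1%R[)
      ((a * C * v (x0 + t *: (x - x0))%R ^+ 2)%:E * (t ^+ n)%:E) =
    \int[lebesgue_measure]_(t in `]0%R, 1%R[) ((a * C)%:E * ((w * w).[t] * t ^+ n)%:E))%E.
  by apply: eq_integral => t _; rewrite wE -!EFinM hornerM expr2 !mulrA.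
rewrite ge0_integralZl//; first last.
- by rewrite lee_fin mulr_ge0// ler0n.
- move=> t; rewrite /= in_itv/= => /andP[/ltW t0 _].
  by rewrite lee_fin mulr_ge0 ?exprn_ge0// hornerM -expr2 sqr_ge0.
- by apply/measurable_EFinP; exact: measurable_funTS.
rewrite -(@integral_itv_bndoo R 0%R 1%R _ true false); last first.
  by apply/measurable_EFinP; exact: measurable_funTS.
rewrite integral_radial_moment -EFinM lee_fin -mulrA ler_wpM2l//.
exact: radial_inverse_inequality.
Qed.

(** * The boundary of a sub-element is negligible *)

Section negligible_boundary.
Context (R : realType) (n : nat).
Local Notation mu := (lebesgue_rV R n.+1).

Lemma negligible_bigcup_ord N (F : 'I_N -> set 'rV[R]_n.+1) :
  (forall j, mu.-negligible (F j)) -> mu.-negligible (\bigcup_j F j).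
Proof.
move=> nF; pose G k := if insub k is Some j then F j else set0.
apply: (@negligibleS _ _ _ _ (\bigcup_k G k)).
  by move=> x [j _ Fx]; exists (val j) => //; rewrite /G valK.
apply: negligible_bigcup => k; rewrite /G; case: insubP => // _.
exact: negligible_set0.
Qed.

Lemma negligible_boundary (K : set 'rV[R]_n.+1) N (cs : 'I_N -> chart R n) :
  open K -> is_atlas K cs -> mu.-negligible (boundary K).
Proof.
move=> oK [Kcs bK].
apply: (@negligibleS _ _ _ _ (\bigcup_j (boundary K `&` chart_nbhs (cs j)))).
  by move=> x Kx; have [j _ jx] := bK _ Kx; exists j.
apply: negligible_bigcup_ord => j; have [mZ Z0] := chart_boundary_null (Kcs j) oK.
exact/negligibleP.
Qed.

(** The closure of [F] stays in the closed set [boundary K], null chart by chart; the planar faces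
    lie in hyperplanes. *)
Lemma negligible_sub_element_boundary (K F KF : set 'rV[R]_n.+1) x0 N
    (cs : 'I_N -> chart R n) : open K -> is_atlas K cs -> F `<=` boundary K ->
  sub_element K F KF x0 -> mu.-negligible (boundary KF).
Proof.
move=> oK atl FK [_ _ _ [P [PH _ ->]] _].
apply: negligibleU.
  apply: negligibleS (negligible_boundary oK atl).
  have cb : closed (boundary K).
    rewrite /boundary setDE; apply: closedI; first exact: closed_closure.
    by apply: open_closedC; exact: open_interior.
  rewrite [X in _ `<=` X](closure_id _).1//; exact: closure_subset.
apply: negligible_bigcup_ord => j; have [a a0 Pa] := PH j.
have [mH H0] := lebesgue_rV_hyperplane x0 a0.
by apply: negligibleS Pa _; exact/negligibleP.
Qed.

End negligible_boundary.

(** * Assembling the cones over the pieces of F *)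

Section sub_element_cones.
Context (R : realType) (n : nat) (K F KF : set 'rV[R]_n.+1) (x0 : 'rV[R]_n.+1).
Context (N : nat) (cs : 'I_N -> chart R n).
Hypothesis oK : open K.
Hypothesis atl : is_atlas K cs.
Hypothesis FK : F `<=` boundary K.
Hypothesis KF_sub : sub_element K F KF x0.
Variables (D : 'I_N -> set 'rV[R]_n.+1) (E : 'I_N -> set 'rV[R]_n).
Hypothesis DF : forall j, D j `<=` F `&` chart_nbhs (cs j).
Hypothesis tD : trivIset setT D.
Hypothesis mE : forall j, measurable (E j).
Hypothesis ED : forall j y, E j y ->
  D j (graph_point (cs j) y) /\ differentiable (chart_fun (cs j)) y.

Definition center_height j : R := (uncons_rV (x0 *m (chart_frame (cs j))^T)).1.
Definition center_base j : 'rV[R]_n := (uncons_rV (x0 *m (chart_frame (cs j))^T)).2.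

Local Notation s0 := center_height.
Local Notation y0 := center_base.
Local Notation flux j := (flux_density (cs j) (s0 j) (y0 j)).

Let Kc j : is_chart K (cs j). Proof. by case: atl. Qed.

Let csQ j : chart_frame (cs j) *m (chart_frame (cs j))^T = 1%:M.
Proof. by case: (Kc j). Qed.

Let csL j : lipschitz (chart_fun (cs j)). Proof. by case: (Kc j). Qed.

Lemma chart_center j : chart_point (cs j) (s0 j) (y0 j) = x0.
Proof.
have [s [y xE]] := chart_pointE (csQ j) x0.
by rewrite /center_height /center_base xE chart_pointK// cons_rVK.
Qed.

Lemma outward_normal_chart j y : E j y ->
  outward_normal K (graph_point (cs j) y)
    ((area_factor (chart_fun (cs j)) y)^-1 *:
      chart_point (cs j) 1 (- gradient (chart_fun (cs j)) y)).
Proof.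
by move=> /ED[/DF[_ Uy] dy]; exists (cs j), y; split.
Qed.

Lemma dot_outward_normal j y :
  dot (graph_point (cs j) y - x0)
    ((area_factor (chart_fun (cs j)) y)^-1 *:
      chart_point (cs j) 1 (- gradient (chart_fun (cs j)) y)) =
  (area_factor (chart_fun (cs j)) y)^-1 * flux j y.
Proof. by rewrite -(chart_center j) (flux_density_normal (Kc j)). Qed.

Lemma flux_gt0 j y : E j y -> 0 < flux j y.
Proof.
move=> Ey; have [_ _ _ _ [_ /(_ (graph_point (cs j) y) _ _ (outward_normal_chart Ey))]] := KF_sub.
have [/DF[Fy _] _] := ED Ey; move=> /(_ Fy); rewrite dot_outward_normal.
by rewrite pmulr_rgt0// invr_gt0 area_factor_gt0.
Qed.

Let G := closure KF.

Let sG : star_shaped G x0.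
Proof. by apply: star_shaped_closure; case: KF_sub => _ _ _ _ []. Qed.

Let FG : F `<=` G. Proof. by case: KF_sub => _ _ FbKF _ _ x /FbKF[]. Qed.

Let mG : measurable G. Proof. exact: measurable_closure. Qed.

Let rho := gauge G x0.

Let proj (x : 'rV[R]_n.+1) : 'rV[R]_n.+1 := x0 + (rho x)^-1 *: (x - x0).

(** The open cone over the graph above [E j], described by preimages under [proj] and [rho] instead
    of as an image, hence measurable. [proj x] is the graph point on the ray through x. *)
Let cone j : set 'rV[R]_n.+1 := G `&` [set x |
  let z := uncons_rV (proj x *m (chart_frame (cs j))^T) in
  E j z.2 /\ z.1 = chart_fun (cs j) z.2] `&` [set x | 0 < rho x < 1].

Let mrho : measurable_fun [set: 'rV[R]_n.+1] (rho : _ -> measurableTypeR R).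
Proof. exact: measurable_gauge. Qed.

Let mcone j : measurable (cone j).
Proof.
have mproj : measurable_fun [set: 'rV[R]_n.+1] proj.
  apply: measurable_fun_rVD; first exact: measurable_cst.
  apply: measurable_fun_rVZ; first exact: (measurableT_comp (@measurable_invr R)).
  by apply: measurable_fun_rVD => //; exact: measurable_cst.
have mz : measurable_fun [set: 'rV[R]_n.+1]
    (fun x => uncons_rV (proj x *m (chart_frame (cs j))^T)).
  apply: (measurableT_comp (@measurable_uncons_rV R n)).
  exact: measurable_fun_rVM.
have mz1 := measurableT_comp (@measurable_fst _ _ _ _) mz.
have mz2 := measurableT_comp (@measurable_snd _ _ _ _) mz.
apply: measurableI; last first.
  rewrite (_ : [set x | _] = rho @^-1` `]0%R, 1%R[%classic).
    by rewrite -[X in measurable X]setTI; exact: mrho.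
  by apply/seteqP; split => x /=; rewrite in_itv.
apply: measurableI => //.
rewrite (_ : [set x | _] = ((fun x => (uncons_rV (proj x *m (chart_frame (cs j))^T)).2) @^-1` E j) `&`
  ((fun x => (uncons_rV (proj x *m (chart_frame (cs j))^T)).1 -
    chart_fun (cs j) (uncons_rV (proj x *m (chart_frame (cs j))^T)).2) @^-1` [set 0])).
  apply: measurableI.
    by rewrite -[X in measurable X]setTI; exact: mz2.
  have md : measurable_fun [set: 'rV[R]_n.+1] (fun x =>
      (uncons_rV (proj x *m (chart_frame (cs j))^T)).1 -
      chart_fun (cs j) (uncons_rV (proj x *m (chart_frame (cs j))^T)).2 : measurableTypeR R).
    apply: measurable_funB => //.
    exact: (measurableT_comp (continuous_measurable_rV (lipschitz_continuous_rV (@csL j)))).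
  by rewrite -[X in measurable X]setTI; exact: md.
apply/seteqP; split => x /= [Ex zE]; split => //.
  by rewrite zE subrr.
by apply/eqP; rewrite -subr_eq0; apply/eqP.
Qed.

(** Just beyond the graph point the ray leaves the closure of [K], hence the smaller closure of
    [KF], which is what the gauge requires. *)
Let rhoE j t y : 0 < t < 1 -> E j y ->
  rho (cone_point (cs j) (s0 j) (y0 j) (t, y)) = t.
Proof.
move=> t01 Ey; have [/DF[Fy Uy] dy] := ED Ey.
have [e0 e00 eP] := above_boundary_point (Kc j) dy Uy (flux_gt0 Ey).
rewrite /cone_point chart_center in eP *.
apply: (gaugeE sG (FG Fy) e00 _ t01) => e e0e Ge; apply: (eP e e0e).
by apply: closure_subset Ge; case: KF_sub => -[].
Qed.

Let coneP j t y : 0 < t < 1 -> E j y ->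
  cone j (cone_point (cs j) (s0 j) (y0 j) (t, y)).
Proof.
move=> t01 Ey; have [/DF[Fy Uy] dy] := ED Ey.
have rE := rhoE t01 Ey; have /andP[t0 t1] := t01.
split; last by rewrite /= rE.
split; first by rewrite /cone_point chart_center; apply: sG; [exact: FG|rewrite t0 ltW].
have pE : proj (cone_point (cs j) (s0 j) (y0 j) (t, y)) = graph_point (cs j) y.
  rewrite /proj rE /cone_point chart_center addrAC subrr add0r scalerA mulVf ?gt_eqF//.
  by rewrite scale1r subrKC.
have zE : uncons_rV (proj (cone_point (cs j) (s0 j) (y0 j) (t, y)) *m
    (chart_frame (cs j))^T) = (chart_fun (cs j) y, y).
  by rewrite pE chart_pointK// cons_rVK.
by hnf; rewrite zE; split.
Qed.

Let proj_cone j x : cone j x -> D j (proj x).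
Proof.
move=> [[_ [Ez zE]] _]; have [Dz _] := ED Ez.
have [s [y pE]] := chart_pointE (csQ j) (proj x).
by move: Ez zE Dz; rewrite pE chart_pointK// cons_rVK/= => _ ->.
Qed.

Let tcone : trivIset setT cone.
Proof.
apply/trivIsetP => i j _ _ ij; apply/seteqP; split => // x [/proj_cone xi /proj_cone xj].
by have /trivIsetP/(_ i j I I ij)/seteqP[+ _] := tD => /(_ (proj x)); apply.
Qed.

(** The cones are disjoint, since [proj] sends them into disjoint [D j], and they lie in the closure
    of [KF], which differs from [KF] by a null set. *)
Lemma sub_element_cone_inequality (f : 'rV[R]_n.+1 -> \bar R) :
  measurable_fun [set: 'rV[R]_n.+1] f -> (forall x, 0 <= f x)%E ->
  (\sum_j \int[lebesgue_rV R n]_(y in E j) ((flux j y)%:E *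
     \int[lebesgue_measure]_(t in `]0%R, 1%R[)
       (f (x0 + t *: (graph_point (cs j) y - x0))%R * (t ^+ n)%:E)) <=
   \int[lebesgue_rV R n.+1]_(x in KF) f x)%E.
Proof.
move=> mf f0.
apply: (@le_trans _ _ (\sum_j \int[lebesgue_rV R n.+1]_(x in cone j) f x)%E).
  apply: lee_sum => j _.
  have := cone_inequality (csQ j) (@csL j) (mE j) (fun y Ey => (ED Ey).2)
    (fun y Ey => ltW (flux_gt0 Ey)) mrho (mcone j) (@rhoE j) (@coneP j) mf f0.
  by rewrite /cone_point chart_center.
rewrite -ge0_integral_bigsetU//; first last.
- exact: measurable_funTS.
- exact: sub_trivIset tcone.
- exact: index_enum_uniq.
have mU : measurable (\big[setU/set0]_(j < N) cone j) by exact: bigsetU_measurable.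
have oKF : open KF by case: KF_sub => -[].
have mbKF : measurable (boundary KF).
  apply: measurableD => //.
  by apply: open_measurable_rV; exact: open_interior.
have bKF0 : lebesgue_rV R n.+1 (boundary KF) = 0%E.
  apply/negligibleP => //; exact: negligible_sub_element_boundary atl FK KF_sub.
apply: (@le_trans _ _ (\int[lebesgue_rV R n.+1]_(x in G) f x)%E).
  apply: ge0_subset_integral => //; first exact: measurable_funTS.
  by rewrite -bigcup_seq => x [j _ [[]]].
rewrite (ge0_negligible_integral mbKF)//; last exact: measurable_funTS.
rewrite (_ : G `\` boundary KF = KF)//.
rewrite /boundary (interior_id _).1//; apply/seteqP; split => x.
  by move=> [Gx /not_andP[//|/contrapT]].
by move=> KFx; split; [exact: subset_closure|case].
Qed.

Variables (p : nat) (v : 'rV[R]_n.+1 -> R).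
Hypothesis pv : poly_space p v.
Local Notation C := (((p + 1) * (p + n.+1))%:R : R).

Let mv : measurable_fun [set: 'rV[R]_n.+1] (fun x => v x ^+ 2 : measurableTypeR R).
Proof. by apply: measurable_funX; exact: measurable_poly_space pv. Qed.

Let mvE : measurable_fun [set: 'rV[R]_n.+1] (fun x => (v x ^+ 2)%:E).
Proof. exact/measurable_EFinP. Qed.

(** The factor [a] is later the inverse of the infimum when this is positive, and 1 in the
    degenerate case. *)
Lemma weighted_trace_inequality (a : R) : 0 <= a ->
  (\sum_j \int[lebesgue_rV R n]_(y in E j)
     (flux j y * (a * v (graph_point (cs j) y) ^+ 2))%:E <=
   (a * C)%:E * sqnorm_volume KF v)%E.
Proof.
move=> a0; have aC0 : 0 <= a * C by rewrite mulr_ge0.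
have oKF : open KF by case: KF_sub => -[].
rewrite /sqnorm_volume -ge0_integralZl//; first last.
- by move=> x _; rewrite lee_fin sqr_ge0.
- exact: measurable_funTS.
- exact: open_measurable_rV.
apply: le_trans (sub_element_cone_inequality (f := fun x => ((a * C)%:E * (v x ^+ 2)%:E)%E) _ _).
- apply: lee_sum => j _; apply: ge0_le_lower_integral => y Ey.
    by rewrite lee_fin mulr_ge0 ?(ltW (flux_gt0 Ey))// mulr_ge0// sqr_ge0.
  rewrite EFinM lee_wpmul2l ?lee_fin ?(ltW (flux_gt0 Ey))//.
  exact: radial_trace_inequality.
- exact: measurable_funeM.
- by move=> x; rewrite mule_ge0// lee_fin// sqr_ge0.
Qed.

Lemma min_m_dot_n_ge0 : (0 <= min_m_dot_n K F x0)%E.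
Proof.
apply: le_ereal_inf_tmp => _ [x [nu [Fx xnu ->]]]; rewrite lee_fin ltW//.
by have [_ _ _ _ [_]] := KF_sub; apply.
Qed.

Lemma min_m_dot_n_le j y : E j y ->
  (min_m_dot_n K F x0 <= ((area_factor (chart_fun (cs j)) y)^-1 * flux j y)%:E)%E.
Proof.
move=> Ey; have [/DF[Fy _] _] := ED Ey; apply: ereal_inf_lbound.
exists (graph_point (cs j) y); eexists; split; [exact: Fy|exact: outward_normal_chart|].
by rewrite dot_outward_normal.
Qed.

(** Covers the case where the bound reads +oo times 0. The integral weighted by the flux is 0, and
    the flux is positive, so v vanishes almost everywhere on each [E j]. *)
Lemma flux_trace_null : sqnorm_volume KF v = 0%E ->
  (\sum_j \int[lebesgue_rV R n]_(y in E j)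
     (v (graph_point (cs j) y) ^+ 2 * area_factor (chart_fun (cs j)) y)%:E = 0)%E.
Proof.
move=> V0; have := weighted_trace_inequality (@ler01 R).
rewrite V0 mule0 => le0; apply: big1 => j _.
have dE y : E j y -> differentiable (chart_fun (cs j)) y by case/ED.
have mg : measurable_fun setT (fun y => v (graph_point (cs j) y) ^+ 2 : measurableTypeR R).
  apply: (measurableT_comp mv); apply: measurable_fun_rVM.
  apply: measurable_fun_cons_rV => //.
  exact: (continuous_measurable_rV (lipschitz_continuous_rV (@csL j))).
have mf : measurable_fun (E j) (fun y => flux j y * (1 * v (graph_point (cs j) y) ^+ 2) : measurableTypeR R).
  apply: measurable_funM; first exact: measurable_flux_density.
  by apply: measurable_funM => //; exact: measurable_funTS.
have int_ge0 k : (0 <= \int[lebesgue_rV R n]_(y in E k)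
     (flux k y * (1 * v (graph_point (cs k) y) ^+ 2))%:E)%E.
  apply: integral_ge0 => y Ey.
  by rewrite lee_fin mulr_ge0 ?(ltW (flux_gt0 Ey))// mul1r sqr_ge0.
have int0 : (\int[lebesgue_rV R n]_(y in E j)
     (flux j y * (1 * v (graph_point (cs j) y) ^+ 2))%:E = 0)%E.
  apply/eqP; rewrite eq_le int_ge0 andbT; apply: le_trans le0.
  by rewrite (bigD1 j)//= leeDl// sume_ge0.
have /ae_eq_integral_abs : measurable_fun (E j)
    (fun y => (flux j y * (1 * v (graph_point (cs j) y) ^+ 2))%:E).
  exact/measurable_EFinP.
move=> /(_ (lebesgue_rV R n) (mE j)) -[+ _].
have -> : (\int[lebesgue_rV R n]_(y in E j)
     `|(flux j y * (1 * v (graph_point (cs j) y) ^+ 2))%:E| = 0)%E.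
  rewrite -[RHS]int0; apply: eq_integral => y; rewrite inE => Ey.
  by rewrite gee0_abs// lee_fin mulr_ge0 ?(ltW (flux_gt0 Ey))// mul1r sqr_ge0.
move=> /(_ erefl) ae0.
rewrite (ae_eq_integral (cst 0%E))//; first exact: integral0.
- apply/measurable_EFinP; apply: measurable_funM; first exact: measurable_funTS.
  exact: measurable_area_factor.
apply: filterS ae0 => y + Ey => /(_ Ey)/= /eqP.
rewrite eqe mul1r mulf_eq0 gt_eqF ?flux_gt0//= => /eqP ->.
by rewrite mul0r.
Qed.

Lemma trace_inequality :
  (\sum_j \int[lebesgue_rV R n]_(y in E j)
     (v (graph_point (cs j) y) ^+ 2 * area_factor (chart_fun (cs j)) y)%:E <=
   C%:E / min_m_dot_n K F x0 * sqnorm_volume KF v)%E.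
Proof.
have C0 : 0 < C by rewrite ltr0n muln_gt0 !addn1 !addnS.
have V0 : (0 <= sqnorm_volume KF v)%E.
  by apply: integral_ge0 => x _; rewrite lee_fin sqr_ge0.
have := min_m_dot_n_ge0; have := min_m_dot_n_le.
case: (min_m_dot_n K F x0) => [r| |]//=; last first.
  (* An infimum +oo makes the bound 0, but a point of any [E j] would give a finite upper bound; so
     all [E j] are empty. *)
  move=> Moo _; rewrite invey mule0 mul0e big1// => j _.
  by rewrite (_ : E j = set0) ?integral_set0//; apply/seteqP; split => // y /Moo.
move=> Mr; rewrite lee_fin le_eqVlt => /predU1P[r0|r0].
  (* Infimum 0, with inverse +oo: the bound is 0 or +oo according to the norm of v on [KF]. *)
  move: V0; rewrite -r0 inve0 le_eqVlt => /predU1P[V0|V0].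
    by rewrite -V0 mule0 flux_trace_null.
  by rewrite gt0_muley ?lte_fin// gt0_mulye// leey.
rewrite inver gt_eqF//.
apply: (@le_trans _ _ ((r^-1 * C)%:E * sqnorm_volume KF v)%E); last first.
  by rewrite mulrC EFinM.
(* With weight 1 / r, the relation r <= flux / area factor bounds the area factor by the weighted
   flux. *)
apply: le_trans (weighted_trace_inequality _); last by rewrite invr_ge0 ltW.
apply: lee_sum => j _; apply: ge0_le_lower_integral => y Ey.
  by rewrite lee_fin mulr_ge0 ?sqr_ge0// ltW// area_factor_gt0.
have := Mr _ _ Ey; rewrite !lee_fin mulrCA [leRHS]mulrC => le_r.
rewrite [flux j y * _]mulrC mulrCA ler_wpM2l ?sqr_ge0// ler_pdivlMl//.
by move: le_r; rewrite ler_pdivlMr// area_factor_gt0.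
Qed.

End sub_element_cones.

Theorem lemma4p4 (R : realType) (n : nat) (K : set 'rV[R]_n.+1)
  (hK : lipschitz_domain K)
  (N : nat) (cs : 'I_N -> chart R n) (hcs : is_atlas K cs)
  (nK : nat) (F KF : 'I_nK -> set 'rV[R]_n.+1) (x0 : 'I_nK -> 'rV[R]_n.+1)
  (hsub : sub_element_assumption K F KF x0)
  (p : nat) (i : 'I_nK) (v : 'rV[R]_n.+1 -> R) (hv : poly_space p v) :
  (sqnorm_surface cs (F i) v <=
   ((p + 1) * (p + n.+1))%:R%:E / min_m_dot_n K (F i) (x0 i)
   * sqnorm_volume (KF i) v)%E.
Proof.
have [_ oK _ _ _] := hK; have [_ _ FK /(_ i) sub_i] := hsub.
have FiK : F i `<=` boundary K by rewrite -FK; exact: bigcup_sup.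
(* Each point of [F i] in the atlas is assigned to the chart of least index containing it, as in
   [surface_integral]; hence disjointness. *)
pose D (j : 'I_N) := F i `&` (chart_nbhs (cs j) `\`
  \bigcup_(k in [set k : 'I_N | (k < j)%N]) chart_nbhs (cs k)).
have DF j : D j `<=` F i `&` chart_nbhs (cs j) by move=> x [Fx []].
have tD : trivIset setT D.
  move=> j k _ _ [x [[_ [jx Njx]] [_ [kx Nkx]]]]; apply/val_inj.
  have [jk|kj|//] := ltngtP (val j) (val k); exfalso.
    by apply: Nkx; exists j.
  by apply: Njx; exists k.
(* Measurable sets of base points that carry the lower integrals defining the surface norm. *)
have /choice[E EP] : forall j, exists E, [/\ measurable E,
    E `<=` [set y | D j (graph_point (cs j) y) /\ differentiable (chart_fun (cs j)) y] &
    chart_integral (cs j) (D j) (fun x => v x ^+ 2) =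
      (\int[lebesgue_rV R n]_(y in E)
        (v (graph_point (cs j) y) ^+ 2 * area_factor (chart_fun (cs j)) y)%:E)%E].
  move=> j; apply: ge0_integral_inner => y _.
  by rewrite lee_fin mulr_ge0 ?sqr_ge0// sqrtr_ge0.
have mE j : measurable (E j) by have [] := EP j.
have ED j y : E j y -> D j (graph_point (cs j) y) /\ differentiable (chart_fun (cs j)) y.
  by have [_ + _] := EP j; apply.
apply: le_trans (trace_inequality oK hcs FiK sub_i DF tD mE ED hv).
by apply: lee_sum => j _; have [_ _ ->] := EP j.
Qed.
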